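(* For the $\beta=1$ calculus with its map $\perp$ for a constant parameter $b$, let $\delta$ be a regular codifferential with at most an order $\frac1\lambda$ singularity and such that $\delta^2$ is a left $A$-module map. Let $\nabla$ be the connection constructed from $(\delta,\perp)$ by the quantum Koszul formula for any given constants $g^{ij}$ forming an invertible matrix and parameters $\tilde k_1,\tilde k_2$ (see context), let $|g|=\det(g^{ij})$, and let $T_i,C_i$ be the torsion and cotorsion coefficients. (1) The classical limit ($\lambda\to0$) of the connection exists and has cotorsion and torsion $$C_1^{cl}=-\frac1{|g|}\Big(\frac2r(g^{11}t+g^{12}+g^{21})+\tilde k_1\Big),\qquad C_2^{cl}=\frac{2g^{11}}{|g|r},$$ $$T_1^{cl}=-\frac1{2|g|}g^{11}\Big(\frac2r(g^{11}t+g^{12})+\tilde k_1\Big),$$ $$T_2^{cl}=\frac1{2|g|}\Big((g^{12}-g^{21})\big(\tfrac2r(g^{11}t+g^{12})+\tilde k_1\big)-g^{11}\big(\tfrac2r(g^{21}t+g^{22})+\tilde k_2\big)-\frac{4|g|}r\Big).$$ (2) The full connection and its torsion can be written in terms of cotorsion as $$\nabla e_1=\frac{g^{12}|g|}{(g^{11})^2}\tilde C_2\,e_1\otimes e_1-\frac{|g|}{g^{11}}\tilde C_2\,e_2\otimes e_1,$$ $$\begin{aligned}\nabla e_2=&-\frac{|g|}{(g^{11})^2}(g^{12}\tilde C_1-g^{22}\tilde C_2)e_1\otimes e_1-\frac{g^{12}}{(g^{11})^2}\tilde C_2\,e_1\otimes e_2\\&+\frac{|g|}{(g^{11})^2}(g^{11}\tilde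 C_1-g^{21}\tilde C_2)e_2\otimes e_1+\frac{|g|}{g^{11}}\tilde C_2\,e_2\otimes e_2,\end{aligned}$$ $$T_1=\frac1{g^{11}}\tilde C_2,\qquad T_2=\frac{|g|}{(g^{11})^2}\big(g^{11}\tilde C_1+(g^{12}-g^{21}+g^{11})\tilde C_2\big)-\frac2r,$$ where $$\tilde C_1=\frac{(g^{11})^2}{2|g|}\Big(\frac2{|g|r}(g^{21}t+g^{22})+\frac{\tilde k_2}{|g|}-\frac{2\lambda}r(g^{11}t+g^{12})-\lambda\tilde k_1\Big),$$ $$\tilde C_2=-\frac{(g^{11})^2}{2|g|}\Big(\frac2r(g^{11}t+g^{12})+\tilde k_1\Big);\qquad \tilde C_i=\frac{C_i-C_i^{cl}}\lambda,$$ with $C_i^{cl}$ the expressions in (1). (3) $C_1=C_2=0$ occurs in this moduli space if and only if $g^{11}=0$, $g^{12}+g^{21}=0$ and $\tilde k_1=0$. In this case $T_1=T_2=0$ also, giving a one-parameter moduli space of weak quantum Levi-Civita connections (torsion and cotorsion free) with parameter $\tilde k_2$. (4) The connections in (3) are quantum Levi-Civita (torsion free and metric compatible) if and only if in addition $g^{22}=-\frac{\lambda g^{12}}2$, and then have the form $$\nabla e_1=-\frac1r e_1\otimes e_1,\qquad \nabla e_2=\Big(\frac1r\big(t-\frac\lambda2\big)-\frac{\tilde k_2}{2g^{12}}\Big)e_1\otimes e_1-\frac{g^{12}}r\,g,$$ where $g$ is the metric.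
   Context: $\lambda$ is a nonzero imaginary parameter. $A$ is the unital $\mathbb{C}$-algebra generated by $r,r^{-1},t$ with $rr^{-1}=r^{-1}r=1$, $[r,t]=\lambda r$. The $\beta=1$ calculus is $[r,\mathrm{d}t]=\lambda\mathrm{d}r$, $[t,\mathrm{d}t]=\lambda\mathrm{d}t$, $[r,\mathrm{d}r]=0$, $[t,\mathrm{d}r]=0$. The 1-forms $e_1=\mathrm{d}r$, $e_2=r\,\mathrm{d}t-t\,\mathrm{d}r$ are central and a free basis of $\Omega^1$; $\Omega=A\oplus\Omega^1\oplus\Omega^2$ with $e_1^2=0$, $e_2^2=-\lambda\mathrm{Vol}$, $e_1e_2+e_2e_1=0$, $\mathrm{Vol}=e_1e_2$ a central basis of $\Omega^2$; $\mathrm{d}e_1=0$, $\mathrm{d}e_2=\frac2r\mathrm{Vol}$. ''Constant'' means an element of $\mathbb{C}$; factors $\frac1r$ are written on the left, e.g. $\frac tr=r^{-1}t$. For a constant $b$, $\perp$ is the degree $-2$ $A$-bimodule map $\Omega\otimes_A\Omega\to\Omega$, zero if one argument has degree 0, with $e_1\perp e_1=0$, $e_1\perp e_2=b$, $e_2\perp e_1=-b$, $e_2\perp e_2=-\lambda b$, $\mathrm{Vol}\perp e_i=-e_i\perp\mathrm{Vol}=b\,e_i$, $\mathrm{Vol}\perp\mathrm{Vol}=2b\,\mathrm{Vol}$. A regular codifferential is a degree $-1$ linear map $\delta:\Omega\to\Omega$ with $\delta(a\omega)-a\delta\omega=\mathrm{d}a\perp\omega$ and $\delta(\omega a)-(\delta\omega)a=\omega\perp_R\mathrm{d}a$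 for some bimodule map $\perp_R:\Omega^n\otimes_A\Omega^1\to\Omega^{n-1}$. With $\mathfrak{j}_\omega(\eta)=\frac12(\omega\perp\eta+\omega\perp_R\eta)$, $\eta\in\Omega^1$, one writes $\mathfrak{j}_{e_i}(e_j)=g^{ij}$, $\mathfrak{j}_{\mathrm{Vol}}(e_i)=\sum_jv^{ij}e_j$ (constants). Every regular $\delta$ has the form $$\delta e_1=\frac{\tilde a_1}\lambda,\quad \delta e_2=\frac{\tilde a_2}\lambda+\frac{2b}r,\quad \delta\mathrm{Vol}=\frac1\lambda(\tilde b_1e_1+\tilde b_2e_2),$$ $$\tilde a_i=\frac2r(g^{i1}t+g^{i2})+\tilde k_i,\quad \tilde b_i=\frac2r(v^{1i}t+v^{2i})+\tilde l_i$$ with constants $\tilde k_i,\tilde l_i$. ''At most an order $\frac1\lambda$ singularity'' means $\tilde k_i,\tilde l_i$ (like $g^{ij},v^{ij},b$) are nonsingular as $\lambda\to0$. The condition that $\delta^2$ is a left $A$-module map is taken in its equivalent form $v^{i2}=g^{1i}$, $v^{i1}=-g^{2i}-\lambda g^{1i}$, $\tilde l_1=-\tilde k_2-\lambda\tilde k_1$, $\tilde l_2=\tilde k_1$, so that $g^{ij}$ are given, $\tilde k_i$ are the parameters of the connection and everything else is determined. In classical limits $g^{ij},\tilde k_i$ stand for their $\lambda\to0$ values (one may take them independent of $\lambda$). Quantum Koszul formula: with $L_\delta(\omega,\eta)=\delta(\omega\eta)-(\delta\omega)\eta-(-1)^{|\omega|}\omega\,\delta\eta$ let $$[[\omega,\eta]]=L_\delta(\omega,\eta)+\omega\perp\mathrm{d}\eta-(-1)^{|\omega|}\mathrm{d}\omega\perp\eta-(-1)^{|\omega|}\mathrm{d}(\omega\perp\eta),\qquad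 \nabla_\omega\eta=\tfrac12[[\omega,\eta]]\quad(\omega\in\Omega^1).$$ The metric is $g=\sum g_{ij}e_i\otimes e_j$ with $(g_{ij})$ the inverse matrix of $(g^{ij})$, and $\nabla\eta=\sum g_{ij}e_i\otimes\nabla_{e_j}\eta$ for $\eta\in\Omega^1$. It satisfies $\nabla(a\eta)=\mathrm{d}a\otimes\eta+a\nabla\eta$ and $\nabla(\eta a)=(\nabla\eta)a+\sigma(\eta\otimes\mathrm{d}a)$ for a bimodule map $\sigma:\Omega^1\otimes_A\Omega^1\to\Omega^1\otimes_A\Omega^1$. Metric compatible means $(\nabla\otimes\mathrm{id})g+(\sigma\otimes\mathrm{id})(\mathrm{id}\otimes\nabla)g=0$. The coefficients $T_i,C_i\in A$ are defined by $\wedge\nabla e_i-\mathrm{d}e_i=T_i\mathrm{Vol}$ (where $\wedge$ denotes the product of $\Omega$) and $(\mathrm{d}\otimes\mathrm{id}-\mathrm{id}\wedge\nabla)g=\sum_iC_i\mathrm{Vol}\otimes e_i$; torsion free and cotorsion free mean these vanish. The classical limit of $\nabla$ is the $\lambda\to0$ limit of its coefficients in the basis $e_i\otimes e_j$.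
   Formalization: Corrected, with a_i=(2/r)(g^{i1}t+g^{i2})+k_i: C̃_1=(g11)²(a_2+λa_1)/(2|g|²), C̃_2=-(g11)²a_1/(2|g|²); e1⊗e2 coefficient of ∇e2 times |g|; T_1=|g|C̃_2/g11; T_2 bracket negated, its +g11 now +λg11; g11=0 in cancelled form. (4): g22=-λg12, and t replaces t-λ/2. *)

(* Defs.v *)
From HB Require Import structures.
From mathcomp Require Import all_boot all_order all_algebra.
From mathcomp Require Import all_classical all_reals all_analysis.
From mathcomp Require Import complex.

Set Implicit Arguments.
Unset Strict Implicit.
Unset Printing Implicit Defensive.

Import Order.TTheory GRing.Theory Num.Theory.
Import numFieldNormedType.Exports.

Local Open Scope ring_scope.

(* The indices 1, 2 are the elements 0, 1 of 'I_2: g^{11} is g 0 0, k_2 is k 1.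
   The complex numbers are a numClosedFieldType C in the definitions and R[i],
   for a realType R, in the theorem. *)

Section Algebra.
Variables (C : numClosedFieldType) (lam : C).

Record rt_relations (A : algType C) (r ri t : A) : Prop := {
  rt_rV : r * ri = 1;
  rt_Vr : ri * r = 1;
  rt_comm : r * t - t * r = lam *: r }.

Record rt_presented (A : algType C) (r ri t : A) : Prop := {
  rtp_rel : rt_relations r ri t;
  rtp_gen : forall P : A -> Prop,
    (forall c : C, P c%:A) -> P r -> P ri -> P t ->
    (forall x y, P x -> P y -> P (x + y)) ->
    (forall x y, P x -> P y -> P (x * y)) -> forall a, P a;
  rtp_free : forall (B : algType C) (r' ri' t' : B),
    rt_relations r' ri' t' ->
    exists f : {lrmorphism A -> B}, [/\ f r = r', f ri = ri' & f t = t'] }.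

End Algebra.

(* Alg is A and Om is Omega, a C-algebra under the wedge product into which A
   embeds by emb. cf0, cf1, cf2 give the coefficients of a form in the basis
   1; e_1, e_2; Vol. *)
Record calculus (C : numClosedFieldType) := Calculus {
  Alg : algType C;
  Om : algType C;
  emb : {lrmorphism Alg -> Om};
  gr : Alg;
  grV : Alg;
  gt : Alg;
  dd : {linear Om -> Om};
  cf0 : Om -> Alg;
  cf1 : Om -> 'I_2 -> Alg;
  cf2 : Om -> Alg }.

Arguments emb {C X} : rename.
Arguments gr {C X} : rename.
Arguments grV {C X} : rename.
Arguments gt {C X} : rename.
Arguments dd {C X} : rename.
Arguments cf0 {C X} : rename.
Arguments cf1 {C X} : rename.
Arguments cf2 {C X} : rename.

Section Calculus.
Variables (C : numClosedFieldType) (X : calculus C).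
Implicit Types (a : Alg X) (w h : Om X) (i j p q : 'I_2).

Definition dr : Om X := dd (emb gr).
Definition dt : Om X := dd (emb gt).

Definition e (i : 'I_2) : Om X :=
  if i == 0 then dr else emb gr * dt - emb gt * dr.

Definition Vol : Om X := e 0 * e 1.

Definition hdeg (n : nat) (w : Om X) : Prop :=
  match n with
  | 0 => exists a, w = emb a
  | 1 => exists a1 a2, w = emb a1 * e 0 + emb a2 * e 1
  | 2 => exists a, w = emb a * Vol
  | _ => w = 0
  end.

Record beta1 (lam : C) : Prop := {
  b1_alg : rt_presented lam (gr : Alg X) grV gt;
  b1_deg : forall n w, hdeg n w -> hdeg n.+1 (dd w);
  b1_leibniz : forall n w h, hdeg n w ->
    dd (w * h) = dd w * h + (-1) ^+ n *: (w * dd h);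
  b1_dd : forall w, dd (dd w) = 0;
  b1_r_dt : emb gr * dt - dt * emb gr = lam *: dr;
  b1_t_dt : emb gt * dt - dt * emb gt = lam *: dt;
  b1_r_dr : emb gr * dr - dr * emb gr = 0;
  b1_t_dr : emb gt * dr - dr * emb gt = 0;
  b1_central : forall a i, emb a * e i = e i * emb a;
  b1_span : forall w,
    w = emb (cf0 w) + (emb (cf1 w 0) * e 0 + emb (cf1 w 1) * e 1)
        + emb (cf2 w) * Vol;
  b1_free : forall a0 a1 a2 a3 w,
    w = emb a0 + (emb a1 * e 0 + emb a2 * e 1) + emb a3 * Vol ->
    [/\ cf0 w = a0, cf1 w 0 = a1, cf1 w 1 = a2 & cf2 w = a3];
  b1_e1e1 : e 0 * e 0 = 0;
  b1_e2e2 : e 1 * e 1 = - lam *: Vol;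
  b1_e1e2 : e 0 * e 1 + e 1 * e 0 = 0;
  b1_de1 : dd (e 0) = 0;
  b1_de2 : dd (e 1) = emb (2 *: grV) * Vol }.

(* Bimodule maps out of a tensor product over A are given as biadditive,
   A-balanced and A-bilinear functions of two arguments, the second one ranging
   over the sub-bimodule P. *)
Record bimod_map2 (P : Om X -> Prop) (f : Om X -> Om X -> Om X) : Prop := {
  bm2_addl : forall w w' h, P h -> f (w + w') h = f w h + f w' h;
  bm2_addr : forall w h h', P h -> P h' -> f w (h + h') = f w h + f w h';
  bm2_left : forall a w h, P h -> f (emb a * w) h = emb a * f w h;
  bm2_right : forall a w h, P h -> f w (h * emb a) = f w h * emb a;
  bm2_bal : forall a w h, P h -> f (w * emb a) h = f w (emb a * h) }.

Record is_perp (lam b : C) (perp : Om X -> Om X -> Om X) : Prop := {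
  perp_bimod : bimod_map2 (fun=> True) perp;
  perp_deg : forall m n k w h,
    hdeg m w -> hdeg n h -> (m + n = k + 2)%N -> hdeg k (perp w h);
  perp_0l : forall w h, hdeg 0 w -> perp w h = 0;
  perp_0r : forall w h, hdeg 0 h -> perp w h = 0;
  perp_e1e1 : perp (e 0) (e 0) = 0;
  perp_e1e2 : perp (e 0) (e 1) = b%:A;
  perp_e2e1 : perp (e 1) (e 0) = - b%:A;
  perp_e2e2 : perp (e 1) (e 1) = - (lam * b)%:A;
  perp_Vole : forall i, perp Vol (e i) = b *: e i;
  perp_eVol : forall i, perp (e i) Vol = - (b *: e i);
  perp_VolVol : perp Vol Vol = (2 * b) *: Vol }.

Section Codifferential.
Variables (perp perpR : Om X -> Om X -> Om X) (delta : {linear Om X -> Om X}).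

Record regular_codiff : Prop := {
  rc_deg0 : forall w, hdeg 0 w -> delta w = 0;
  rc_deg : forall n w, hdeg n.+1 w -> hdeg n (delta w);
  rc_left : forall a w,
    delta (emb a * w) - emb a * delta w = perp (dd (emb a)) w;
  rc_right : forall a w,
    delta (w * emb a) - delta w * emb a = perpR w (dd (emb a));
  rc_bimod : bimod_map2 (hdeg 1) perpR;
  rc_perpR0 : forall w h, hdeg 0 w -> hdeg 1 h -> perpR w h = 0;
  rc_perpR_deg : forall n w h, hdeg n.+1 w -> hdeg 1 h -> hdeg n (perpR w h) }.

Definition jj (w h : Om X) : Om X := 2^-1 *: (perp w h + perpR w h).

(* (2/r) (x t + y) + z *)
Definition affine_t (x y z : C) : Alg X :=
  (2 *: grV) * (x *: gt + y%:A) + z%:A.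

Definition atil (g : 'M[C]_2) (k : 'I_2 -> C) (i : 'I_2) : Alg X :=
  affine_t (g i 0) (g i 1) (k i).

Definition btil (v : 'M[C]_2) (l : 'I_2 -> C) (i : 'I_2) : Alg X :=
  affine_t (v 0 i) (v 1 i) (l i).

(* delta is a regular codifferential with constants g^{ij}, v^{ij}, k_i, l_i
   and delta^2 a left A-module map. The equations mod_v, mod_l imply
   mod_delta2, and are equivalent to it when b != 0; for b = 0 mod_delta2 is
   void, and mod_v, mod_l are then the meaning of the condition on delta^2. *)
Record in_moduli (lam b : C) (g v : 'M[C]_2) (k l : 'I_2 -> C) : Prop := {
  mod_perp : is_perp lam b perp;
  mod_reg : regular_codiff;
  mod_delta2 : forall a w,
    delta (delta (emb a * w)) = emb a * delta (delta w);
  mod_jg : forall i j, jj (e i) (e j) = (g i j)%:A;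
  mod_jv : forall i, jj Vol (e i) = v i 0 *: e 0 + v i 1 *: e 1;
  mod_delta_e1 : delta (e 0) = emb (lam^-1 *: atil g k 0);
  mod_delta_e2 : delta (e 1) = emb (lam^-1 *: atil g k 1 + (2 * b) *: grV);
  mod_delta_Vol : delta Vol =
    lam^-1 *: (emb (btil v l 0) * e 0 + emb (btil v l 1) * e 1);
  mod_v : forall i, v i 1 = g 0 i /\ v i 0 = - g 1 i - lam * g 0 i;
  mod_l : l 0 = - k 1 - lam * k 0 /\ l 1 = k 0;
  mod_unit : g \in unitmx }.

(* n stands for |w|, the degree of w. *)
Definition L_delta (n : nat) (w h : Om X) : Om X :=
  delta (w * h) - delta w * h - (-1) ^+ n *: (w * delta h).

Definition koszul (n : nat) (w h : Om X) : Om X :=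
  L_delta n w h + perp w (dd h) - (-1) ^+ n *: perp (dd w) h
  - (-1) ^+ n *: dd (perp w h).

Definition nabla_along (w h : Om X) : Om X := 2^-1 *: koszul 1 w h.

End Codifferential.

(* Omega^1 (x)_A Omega^1 is free on the central elements e_i (x) e_j; the matrix
   M stands for \sum_(i, j) M i j e_i (x) e_j, so delta_mx i j is e_i (x) e_j,
   and a *: M is the left action. *)
Definition tens (w h : Om X) : 'M[Alg X]_2 :=
  \matrix_(i, j) (cf1 w i * cf1 h j).

Definition rmul (M : 'M[Alg X]_2) (a : Alg X) : 'M[Alg X]_2 :=
  map_mx (fun x => x * a) M.

Definition metric (g : 'M[C]_2) : 'M[Alg X]_2 :=
  map_mx (fun c : C => c%:A) (invmx g).

Definition nabla (perp : Om X -> Om X -> Om X) (delta : {linear Om X -> Om X})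
    (g : 'M[C]_2) (h : Om X) : 'M[Alg X]_2 :=
  \sum_i \sum_j tens (invmx g i j *: e i) (nabla_along perp delta (e j) h).

Section Connection.
Variable nab : Om X -> 'M[Alg X]_2.

Record left_connection : Prop := {
  lc_add : forall w h, hdeg 1 w -> hdeg 1 h -> nab (w + h) = nab w + nab h;
  lc_leibniz : forall a h, hdeg 1 h ->
    nab (emb a * h) = tens (dd (emb a)) h + a *: nab h }.

Record generalised_braiding (sigma : 'M[Alg X]_2 -> 'M[Alg X]_2) : Prop := {
  gb_add : forall M N, sigma (M + N) = sigma M + sigma N;
  gb_left : forall a M, sigma (a *: M) = a *: sigma M;
  gb_right : forall a M, sigma (rmul M a) = rmul (sigma M) a;
  gb_leibniz : forall a h, hdeg 1 h ->
    nab (h * emb a) = rmul (nab h) a + sigma (tens h (dd (emb a))) }.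

(* The (p, q, j) entries of (nabla (x) id) m and of (sigma (x) id)(id (x) nabla) m
   in the basis e_p (x) e_q (x) e_j. *)
Definition nabla_id (m : 'M[Alg X]_2) (p q j : 'I_2) : Alg X :=
  \sum_i nab (emb (m i j) * e i) p q.

Definition sigma_id_nabla (sigma : 'M[Alg X]_2 -> 'M[Alg X]_2)
    (m : 'M[Alg X]_2) (p q j : 'I_2) : Alg X :=
  sigma (\matrix_(i, s) \sum_k m i k * nab (e k) s j) p q.

Definition metric_compatible (m : 'M[Alg X]_2) : Prop :=
  exists sigma, generalised_braiding sigma /\
    forall p q j, nabla_id m p q j + sigma_id_nabla sigma m p q j = 0.

Definition wedge (M : 'M[Alg X]_2) : Om X :=
  \sum_i \sum_j emb (M i j) * e i * e j.

(* The argument of cf2 is a 2-form, so it is emb (torsion i) * Vol. *)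
Definition torsion (i : 'I_2) : Alg X := cf2 (wedge (nab (e i)) - dd (e i)).

(* The argument of cf2 is the 2-form in front of (x) e_j in
   (d (x) id - id /\ nabla) m. *)
Definition cotorsion (m : 'M[Alg X]_2) (j : 'I_2) : Alg X :=
  cf2 (\sum_i dd (emb (m i j) * e i)
       - \sum_i \sum_k \sum_p
           emb (m i k) * e i * (emb (nab (e k) p j) * e p)).

Definition torsion_free : Prop := forall i, torsion i = 0.
Definition cotorsion_free (m : 'M[Alg X]_2) : Prop :=
  forall j, cotorsion m j = 0.

Definition quantum_levi_civita (m : 'M[Alg X]_2) : Prop :=
  torsion_free /\ metric_compatible m.

Definition weak_quantum_levi_civita (m : 'M[Alg X]_2) : Prop :=
  torsion_free /\ cotorsion_free m.

End Connection.

Section Formulas.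
Variables (lam : C) (g : 'M[C]_2) (k : 'I_2 -> C).
Let D : C := \det g.

Definition cotorsion_cl (i : 'I_2) : Alg X :=
  if i == 0 then - D^-1 *: affine_t (g 0 0) (g 0 1 + g 1 0) (k 0)
  else (2 * g 0 0 / D) *: grV.

Definition torsion_cl (i : 'I_2) : Alg X :=
  if i == 0 then - (g 0 0 / (2 * D)) *: affine_t (g 0 0) (g 0 1) (k 0)
  else (2 * D)^-1 *:
    ((g 0 1 - g 1 0) *: affine_t (g 0 0) (g 0 1) (k 0)
     - g 0 0 *: affine_t (g 1 0) (g 1 1) (k 1)
     - (4 * D) *: grV).

(* (g^{11})^2 *: cored i is the explicit value of (C_i - C_i^cl) / lam. It
   corrects the published one, in which the two terms with lam in C~_1 have the
   opposite sign and lack a factor 1/|g|, and C~_2 lacks a factor 1/|g|. *)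
Definition cored (i : 'I_2) : Alg X :=
  if i == 0 then
    (2 * D)^-1 *: (D^-1 *: affine_t (g 1 0) (g 1 1) (k 1)
                   + (lam / D) *: affine_t (g 0 0) (g 0 1) (k 0))
  else - (2 * D ^+ 2)^-1 *: affine_t (g 0 0) (g 0 1) (k 0).

End Formulas.

(* The weak quantum Levi-Civita connections built from g with k_1 = 0 and
   k_2 = kap. *)
Definition wqlc_with (lam b : C) (perp : Om X -> Om X -> Om X)
    (g : 'M[C]_2) (kap : C) (nab : Om X -> 'M[Alg X]_2) : Prop :=
  exists (delta : {linear Om X -> Om X}) (perpR : Om X -> Om X -> Om X)
         (v : 'M[C]_2) (l : 'I_2 -> C),
    [/\ in_moduli perp perpR delta lam b g v (fun i => if i == 0 then 0 else kap) l,
        nab = nabla perp delta g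
      & weak_quantum_levi_civita nab (metric g)].

End Calculus.

Arguments e {C X} i.
Arguments Vol {C X}.
Arguments metric {C X} g.
Arguments cotorsion_cl {C X} g k i.
Arguments torsion_cl {C X} g k i.
Arguments cored {C X} lam g k i.

Local Open Scope classical_set_scope.

Definition imag_at0 (C : numClosedFieldType) : set_system C :=
  within [set lam : C | 'Re lam = 0] (0 : C)^'.
Arguments imag_at0 {C}.

Definition limit_at0 (C : numClosedFieldType) (f : C -> C) (c : C) : Prop :=
  f lam @[lam --> imag_at0] --> c.

Definition nonsingular (C : numClosedFieldType) (f : C -> C) : Prop :=
  exists c : C, limit_at0 f c.

Definition monomial (C : numClosedFieldType) (X : calculus C)
    (mn : int * nat) : Alg X :=
  (match mn.1 with Posz m => gr ^+ m | Negz m => grV ^+ m.+1 end) * gt ^+ mn.2.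
Arguments monomial {C} X mn.

(* The algebras A vary with lam; they are compared through their common basis
   r^m t^n, and an element has a limit when it lies in the span of finitely many
   of these, independently of lam, and its coefficients converge. *)
Definition alg_limit (C : numClosedFieldType) (X : C -> calculus C)
    (a : forall lam, Alg (X lam)) (a0 : Alg (X 0)) : Prop :=
  exists (s : seq (int * nat)) (c : int * nat -> C -> C) (c0 : int * nat -> C),
    [/\ \forall lam \near imag_at0,
          a lam = \sum_(p <- s) c p lam *: monomial (X lam) p,
        a0 = \sum_(p <- s) c0 p *: monomial (X 0) p
      & forall p, p \in s -> limit_at0 (c p) (c0 p)].

(* Main.v *)
From HB Require Import structures.
Require Import Defs.
From mathcomp Require Import all_boot all_order all_algebra.
From mathcomp Require Import all_classical all_reals all_analysis.
From mathcomp Require Import complex.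
From mathcomp Require Import ring.
Import Order.TTheory GRing.Theory Num.Theory.
Import numFieldNormedType.Exports.
Local Open Scope classical_set_scope.
Local Open Scope ring_scope.

Set Implicit Arguments.
Unset Strict Implicit.
Unset Printing Implicit Defensive.

(* All coefficients occurring here lie in the span of r^-1 t, r^-1 and 1 over
   the constants. Evaluating the quantum Koszul formula on the basis forms, the
   terms in b cancel, and the conditions making delta^2 left A-linear cancel the
   poles in lam; what remains, with A_i = (2/r)(g^{i1} t + g^{i2}) + k_i,
     nabla_{e_1} e_1 = 0,          nabla_{e_1} e_2 = - A_1 e_1 / 2,
     nabla_{e_2} e_1 = A_1 e_1 / 2,
     nabla_{e_2} e_2 = ((A_2 + lam A_1) e_1 - A_1 e_2) / 2,
   makes sense at lam = 0 as well. Torsion and cotorsion are then linear in these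
   coefficients. In A, commutators with r^-1 t and r^-1 are lam times the partial
   derivatives; this gives both the linear independence of r^-1 t, r^-1, 1 for
   lam != 0 and the braiding sigma, which has constant coefficients, so that
   metric compatibility becomes a finite system of scalar equations. *)

(** * The two-element index set and matrices of size 2 *)

Lemma ord2_ind (P : 'I_2 -> Prop) : P 0 -> P 1 -> forall i, P i.
Proof.
move=> P0 P1 [[|[|//]] lti].
- by rewrite (_ : Ordinal lti = 0) //; apply: val_inj.
- by rewrite (_ : Ordinal lti = 1) //; apply: val_inj.
Qed.

Lemma sum_ord2 (V : nmodType) (F : 'I_2 -> V) : \sum_i F i = F 0 + F 1.
Proof.
rewrite big_ord_recl big_ord1.
by congr (F _ + F _); apply: val_inj.
Qed.

Lemma det_mx2 (A : comNzRingType) (g : 'M[A]_2) :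
  \det g = g 0 0 * g 1 1 - g 0 1 * g 1 0.
Proof.
rewrite (expand_det_row _ 0) sum_ord2 /cofactor !det_mx11 !mxE.
have -> : lift 0 0 = 1 :> 'I_2 by apply: val_inj.
have -> : lift 1 0 = 0 :> 'I_2 by apply: val_inj.
by rewrite /= expr0 expr1 mul1r mulN1r mulrN.
Qed.

Lemma invmx2E (F : fieldType) (g : 'M[F]_2) : g \in unitmx ->
  [/\ invmx g 0 0 = g 1 1 / \det g, invmx g 0 1 = - (g 0 1 / \det g),
      invmx g 1 0 = - (g 1 0 / \det g) & invmx g 1 1 = g 0 0 / \det g].
Proof.
move=> ug; rewrite /invmx ug !mxE /cofactor !det_mx11 !mxE.
have -> : lift 0 0 = 1 :> 'I_2 by apply: val_inj.
have -> : lift 1 0 = 0 :> 'I_2 by apply: val_inj.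
by rewrite /= addn0 expr0 expr1 expr2; split; field;
  rewrite -unitfE -[_ \is a _]unitmxE.
Qed.

(** * Coefficients of forms in the basis 1, e_1, e_2, Vol over A *)

Section FreeForms.
Variables (C : numClosedFieldType) (X : calculus C) (lam : C).
Hypothesis XB : beta1 X lam.
Implicit Types (a : Alg X) (w h : Om X) (i j p q : 'I_2).

Lemma emb_alg (c : C) : emb (c%:A : Alg X) = c%:A.
Proof. by rewrite linearZ rmorph1. Qed.

Lemma vol_central a : emb a * Vol = Vol * emb a.
Proof. by rewrite mulrA (b1_central XB) -mulrA (b1_central XB) mulrA. Qed.

(** By [b1_free] the coefficients can be read off any expansion, so it suffices to regroup the sum
    of the two expansions. The rules for products with elements of A follow in the same way, those
    on the right by centrality of the basis. *)
Lemma cf_add w h : [/\ cf0 (w + h) = cf0 w + cf0 h,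
  cf1 (w + h) 0 = cf1 w 0 + cf1 h 0, cf1 (w + h) 1 = cf1 w 1 + cf1 h 1
  & cf2 (w + h) = cf2 w + cf2 h].
Proof.
apply: (b1_free XB); rewrite {1}(b1_span XB w) {1}(b1_span XB h).
rewrite !rmorphD /= !mulrDl addrACA; congr (_ + _).
by rewrite addrACA; congr (_ + _); rewrite addrACA.
Qed.

Lemma cf1D w h i : cf1 (w + h) i = cf1 w i + cf1 h i.
Proof. by move: i; apply: ord2_ind; case: (cf_add w h). Qed.

Lemma cf2D w h : cf2 (w + h) = cf2 w + cf2 h.
Proof. by case: (cf_add w h). Qed.

Lemma cf_mull a w : [/\ cf0 (emb a * w) = a * cf0 w,
  cf1 (emb a * w) 0 = a * cf1 w 0, cf1 (emb a * w) 1 = a * cf1 w 1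
  & cf2 (emb a * w) = a * cf2 w].
Proof.
apply: (b1_free XB); rewrite {1}(b1_span XB w).
by rewrite !mulrDr !mulrA !rmorphM.
Qed.

Lemma cf1_mull a w i : cf1 (emb a * w) i = a * cf1 w i.
Proof. by move: i; apply: ord2_ind; case: (cf_mull a w). Qed.

Lemma cf2_mull a w : cf2 (emb a * w) = a * cf2 w.
Proof. by case: (cf_mull a w). Qed.

Lemma cf_mulr a w : [/\ cf0 (w * emb a) = cf0 w * a,
  cf1 (w * emb a) 0 = cf1 w 0 * a, cf1 (w * emb a) 1 = cf1 w 1 * a
  & cf2 (w * emb a) = cf2 w * a].
Proof.
apply: (b1_free XB); rewrite {1}(b1_span XB w).
rewrite !mulrDl -(mulrA _ Vol) -(mulrA _ (e 0)) -(mulrA _ (e 1)).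
rewrite -vol_central -!(b1_central XB).
by rewrite !rmorphM !mulrA.
Qed.

Lemma cf1_mulr a w i : cf1 (w * emb a) i = cf1 w i * a.
Proof. by move: i; apply: ord2_ind; case: (cf_mulr a w). Qed.

Lemma cf2_mulr a w : cf2 (w * emb a) = cf2 w * a.
Proof. by case: (cf_mulr a w). Qed.

Lemma cf1Z (c : C) w i : cf1 (c *: w) i = c *: cf1 w i.
Proof. by rewrite -mulr_algl -emb_alg cf1_mull mulr_algl. Qed.

Lemma cf2Z (c : C) w : cf2 (c *: w) = c *: cf2 w.
Proof. by rewrite -mulr_algl -emb_alg cf2_mull mulr_algl. Qed.

Lemma cf1N w i : cf1 (- w) i = - cf1 w i.
Proof. by rewrite -scaleN1r cf1Z scaleN1r. Qed.

Lemma cf2N w : cf2 (- w) = - cf2 w.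
Proof. by rewrite -scaleN1r cf2Z scaleN1r. Qed.

Lemma cf1_0 i : cf1 (0 : Om X) i = 0.
Proof. by rewrite -[0 in LHS](scale0r (1 : Om X)) cf1Z scale0r. Qed.

Lemma cf_emb a : [/\ cf0 (emb a) = a, cf1 (emb a) 0 = 0, cf1 (emb a) 1 = 0
  & cf2 (emb a) = 0].
Proof. by apply: (b1_free XB); rewrite !rmorph0 !mul0r !addr0. Qed.

Lemma cf1_emb a i : cf1 (emb a) i = 0.
Proof. by move: i; apply: ord2_ind; case: (cf_emb a). Qed.

Lemma cf_e1 : [/\ cf0 (e 0 : Om X) = 0, cf1 (e 0 : Om X) 0 = 1,
  cf1 (e 0 : Om X) 1 = 0 & cf2 (e 0 : Om X) = 0].
Proof.
by apply: (b1_free XB); rewrite !rmorph0 rmorph1 mul1r !mul0r !addr0 add0r.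
Qed.

Lemma cf_e2 : [/\ cf0 (e 1 : Om X) = 0, cf1 (e 1 : Om X) 0 = 0,
  cf1 (e 1 : Om X) 1 = 1 & cf2 (e 1 : Om X) = 0].
Proof.
by apply: (b1_free XB); rewrite !rmorph0 rmorph1 mul1r !mul0r addr0 !add0r.
Qed.

Lemma cf1_e i j : cf1 (e i : Om X) j = (i == j)%:R.
Proof.
by move: i j; apply: ord2_ind; apply: ord2_ind; case: cf_e1; case: cf_e2.
Qed.

Lemma cf2_e i : cf2 (e i : Om X) = 0.
Proof. by move: i; apply: ord2_ind; case: cf_e1; case: cf_e2. Qed.

Lemma cf_Vol : [/\ cf0 (Vol : Om X) = 0, cf1 (Vol : Om X) 0 = 0,
  cf1 (Vol : Om X) 1 = 0 & cf2 (Vol : Om X) = 1].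
Proof.
by apply: (b1_free XB); rewrite !rmorph0 rmorph1 mul1r !mul0r !add0r.
Qed.

Lemma cf1_Vol i : cf1 (Vol : Om X) i = 0.
Proof. by move: i; apply: ord2_ind; case: cf_Vol. Qed.

Lemma cf2_Vol : cf2 (Vol : Om X) = 1.
Proof. by case: cf_Vol. Qed.

Lemma e2e1 : e 1 * e 0 = - Vol :> Om X.
Proof. by apply/eqP; rewrite -addr_eq0 addrC (b1_e1e2 XB). Qed.

Lemma hdeg1_sum w : hdeg 1 w -> w = emb (cf1 w 0) * e 0 + emb (cf1 w 1) * e 1.
Proof.
move=> [a1 [a2 ->]]; rewrite !cf1D !cf1_mull !cf1_e /=.
by rewrite !mulr1 !mulr0 addr0 add0r.
Qed.

Lemma hdeg0_mem n : hdeg n (0 : Om X).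
Proof.
case: n => [|[|[|//]]] /=; first by exists 0; rewrite rmorph0.
- by exists 0, 0; rewrite !rmorph0 !mul0r addr0.
- by exists 0; rewrite !rmorph0 !mul0r.
Qed.

Lemma hdeg_emb a : hdeg 0 (emb a).
Proof. by exists a. Qed.

Lemma hdeg_e i : hdeg 1 (e i : Om X).
Proof.
move: i; apply: ord2_ind; [exists 1, 0 | exists 0, 1];
by rewrite rmorph0 rmorph1 mul0r mul1r ?addr0 ?add0r.
Qed.

Lemma hdegD w h : hdeg 1 w -> hdeg 1 h -> hdeg 1 (w + h).
Proof.
move=> [a1 [a2 ->]] [b1 [b2 ->]]; exists (a1 + b1), (a2 + b2).
by rewrite !rmorphD !mulrDl addrACA.
Qed.

Lemma hdeg_mull a w : hdeg 1 w -> hdeg 1 (emb a * w).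
Proof.
move=> [a1 [a2 ->]]; exists (a * a1), (a * a2).
by rewrite !rmorphM mulrDr !mulrA.
Qed.

Lemma hdeg_demb a : hdeg 1 (dd (emb a)).
Proof. exact: (b1_deg XB (hdeg_emb a)). Qed.

Lemma demb a : dd (emb a) =
  emb (cf1 (dd (emb a)) 0) * e 0 + emb (cf1 (dd (emb a)) 1) * e 1.
Proof. exact: hdeg1_sum (hdeg_demb a). Qed.

Lemma dembM a a' : dd (emb (a * a')) = dd (emb a) * emb a' + emb a * dd (emb a').
Proof. by rewrite rmorphM (b1_leibniz XB _ (hdeg_emb a)) expr0 scale1r. Qed.

Lemma d_mull a w : dd (emb a * w) = dd (emb a) * w + emb a * dd w.
Proof. by rewrite (b1_leibniz XB _ (hdeg_emb a)) expr0 scale1r. Qed.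

(** The Leibniz rule for 1 * 1 gives d1 = d1 + d1. *)
Lemma d_alg (c : C) : dd (c%:A : Om X) = 0.
Proof.
rewrite linearZ /=; suff -> : dd (1 : Om X) = 0 by rewrite scaler0.
have := dembM 1 1; rewrite !rmorph1 !mulr1 mul1r rmorph1.
by move/eqP; rewrite -subr_eq0 opprD addNKr oppr_eq0 => /eqP.
Qed.

End FreeForms.

(** * The span of r^-1 t, r^-1 and 1 over the constants *)

Section Span.
Variables (C : numClosedFieldType) (X : calculus C).

(** In this form an identity in the noncommutative algebra A reduces to three scalar identities. *)
Definition lin3 (x y z : C) : Alg X := x *: (grV * gt) + y *: grV + z%:A.

Lemma lin3D x y z x' y' z' :
  lin3 x y z + lin3 x' y' z' = lin3 (x + x') (y + y') (z + z').
Proof. by rewrite /lin3 !scalerDl addrACA; congr (_ + _); rewrite addrACA. Qed.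

Lemma lin3Z c x y z : c *: lin3 x y z = lin3 (c * x) (c * y) (c * z).
Proof. by rewrite /lin3 !scalerDr !scalerA. Qed.

Lemma lin3N x y z : - lin3 x y z = lin3 (- x) (- y) (- z).
Proof. by rewrite -scaleN1r lin3Z !mulN1r. Qed.

Lemma lin3_0 : lin3 0 0 0 = 0.
Proof. by rewrite /lin3 !scale0r !addr0. Qed.

Lemma affine_lin3 x y z : affine_t X x y z = lin3 (2 * x) (2 * y) z.
Proof.
by rewrite /affine_t /lin3 mulrDr -!scalerAl -!scalerAr !mulr1 !scalerA.
Qed.

Lemma grV_lin3 : grV = lin3 0 1 0.
Proof. by rewrite /lin3 !scale0r scale1r addr0 add0r. Qed.

Lemma alg_lin3 (c : C) : c%:A = lin3 0 0 c.
Proof. by rewrite /lin3 !scale0r !add0r. Qed.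

Lemma one_lin3 : 1 = lin3 0 0 1.
Proof. by rewrite -alg_lin3 scale1r. Qed.

Definition lin3E := (affine_lin3, grV_lin3, alg_lin3, lin3Z, lin3N, lin3D).

End Span.

Lemma lin3_eq (C : numClosedFieldType) (X : calculus C) (x y z x' y' z' : C) :
  x = x' -> y = y' -> z = z' -> lin3 X x y z = lin3 X x' y' z'.
Proof. by move=> -> -> ->. Qed.

(** * Normal form of 1-forms *)

Section OneForms.
Variables (C : numClosedFieldType) (X : calculus C).

Definition oneform (x y : Alg X) : Om X := emb x * e 0 + emb y * e 1.

Lemma oneformD x y x' y' :
  oneform x y + oneform x' y' = oneform (x + x') (y + y').
Proof. by rewrite /oneform !rmorphD !mulrDl addrACA. Qed.

Lemma oneform_mull a x y : emb a * oneform x y = oneform (a * x) (a * y).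
Proof. by rewrite /oneform !rmorphM mulrDr !mulrA. Qed.

Lemma oneformZ c x y : c *: oneform x y = oneform (c *: x) (c *: y).
Proof.
by rewrite -mulr_algl -emb_alg oneform_mull !mulr_algl.
Qed.

Lemma oneformN x y : - oneform x y = oneform (- x) (- y).
Proof. by rewrite -scaleN1r oneformZ !scaleN1r. Qed.

Lemma emb_e1 x : emb x * e 0 = oneform x 0.
Proof. by rewrite /oneform rmorph0 mul0r addr0. Qed.

Lemma emb_e2 y : emb y * e 1 = oneform 0 y.
Proof. by rewrite /oneform rmorph0 mul0r add0r. Qed.

Lemma e1_oneform : e 0 = oneform 1 0.
Proof. by rewrite -emb_e1 rmorph1 mul1r. Qed.

Lemma e2_oneform : e 1 = oneform 0 1.
Proof. by rewrite -emb_e2 rmorph1 mul1r. Qed.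

Lemma oneform0 : oneform 0 0 = 0.
Proof. by rewrite -emb_e1 rmorph0 mul0r. Qed.

End OneForms.

(** Brings both sides to the form [lin3] and compares the three coefficients by [field], whose
    nonvanishing conditions are met by hypotheses in the context such as [lam0]. *)
Ltac lin3_solve :=
  rewrite /= ?(addr0, add0r, subr0, sub0r, oppr0, mulr0, mulr1, scaler0)
    ?mulrN ?mulr_algr /atil -?lin3_0 ?lin3E ?one_lin3 ?lin3E;
  apply: lin3_eq; by field.

(** * The quantum Koszul bracket of basis forms *)

Section Koszul.
Variables (C : numClosedFieldType) (X : calculus C) (lam b : C).
Variables (perp perpR : Om X -> Om X -> Om X) (delta : {linear Om X -> Om X}).
Variables (g v : 'M[C]_2) (k l : 'I_2 -> C).
Hypothesis XB : beta1 X lam.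
Hypothesis lam0 : lam != 0.
Hypothesis M : in_moduli perp perpR delta lam b g v k l.
Implicit Types (a : Alg X) (w h : Om X) (i j p q : 'I_2).

Let P := mod_perp M.
Let PB := perp_bimod P.
Let R := mod_reg M.

Lemma perpDl w w' h : perp (w + w') h = perp w h + perp w' h.
Proof. exact: (bm2_addl PB). Qed.

Lemma perpDr w h h' : perp w (h + h') = perp w h + perp w h'.
Proof. exact: (bm2_addr PB). Qed.

Lemma perp_mull a w h : perp (emb a * w) h = emb a * perp w h.
Proof. exact: (bm2_left PB). Qed.

Lemma perp_mulr a w h : perp w (h * emb a) = perp w h * emb a.
Proof. exact: (bm2_right PB). Qed.

Lemma perp_mid a w h : emb a * w = w * emb a ->
  perp w (emb a * h) = emb a * perp w h.
Proof. by move=> c; rewrite -(bm2_bal PB) // -c perp_mull. Qed.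

Lemma perp_e_mull a i h : perp (e i) (emb a * h) = emb a * perp (e i) h.
Proof. by apply: perp_mid; apply: (b1_central XB). Qed.

Lemma perp0l h : perp 0 h = 0.
Proof.
by rewrite -[X in perp X](mul0r (0 : Om X)) -{1}(rmorph0 emb) perp_mull
  rmorph0 mul0r.
Qed.

Lemma perp0r w : perp w 0 = 0.
Proof.
by rewrite -[X in perp _ X](mulr0 (0 : Om X)) -{2}(rmorph0 emb) perp_mulr
  rmorph0 mulr0.
Qed.

Lemma perpZl c w h : perp (c *: w) h = c *: perp w h.
Proof. by rewrite -mulr_algl -emb_alg perp_mull emb_alg mulr_algl. Qed.

Lemma perpZr c w h : perp w (c *: h) = c *: perp w h.
Proof. by rewrite -mulr_algr -emb_alg perp_mulr emb_alg mulr_algr. Qed.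

(** The coefficient of e_p in nabla_{e_i} e_j. Neither b nor lam^-1 occurs, so it makes sense at lam
    = 0 as well. *)
Definition christoffel (i j p : 'I_2) : Alg X :=
  if j == 0 then (if (i == 1) && (p == 0) then 2^-1 *: atil X g k 0 else 0)
  else if i == 0 then (if p == 0 then - (2^-1 *: atil X g k 0) else 0)
  else if p == 0 then 2^-1 *: (atil X g k 1 + lam *: atil X g k 0)
  else - (2^-1 *: atil X g k 0).

Lemma koszul1E w h : koszul perp delta 1 w h =
  delta (w * h) - delta w * h + w * delta h + perp w (dd h)
  + perp (dd w) h + dd (perp w h).
Proof. by rewrite /koszul /L_delta expr1 !scaleN1r !opprK. Qed.

Lemma koszul_basis : let a i := atil X g k i in
  [/\ koszul perp delta 1 (e 0) (e 0) = 0,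
      koszul perp delta 1 (e 0) (e 1) = emb (- a 0) * e 0,
      koszul perp delta 1 (e 1) (e 0) = emb (a 0) * e 0
    & koszul perp delta 1 (e 1) (e 1) =
        emb (a 1 + lam *: a 0) * e 0 - emb (a 0) * e 1].
Proof.
have [v01 v00] := mod_v M 0; have [v11 v10] := mod_v M 1.
have [l0 l1] := mod_l M.
have two : (2 : C) != 0 by rewrite pnatr_eq0.
have dN : delta (- Vol) = - delta Vol by apply: linearN.
have dZ : delta (- lam *: Vol) = - lam *: delta Vol by apply: linearZ.
have dP (c : C) : dd (- c%:A : Om X) = 0 by rewrite linearN /= (d_alg XB) oppr0.
have d0 : delta 0 = 0 by apply: linear0.
have dd0 : dd (0 : Om X) = 0 by apply: linear0.
pose a i := atil X g k i.
(* The conditions [mod_v] and [mod_l] express delta Vol through the coefficients of delta e_1 and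
   delta e_2. *)
have b0 : btil X v l 0 = - a 1 - lam *: a 0.
  by rewrite /a /btil v00 v10 l0; lin3_solve.
have b1 : btil X v l 1 = a 0 by rewrite /a /atil /btil v01 v11 l1.
rewrite /a in b0 b1.
have lamK (x : Om X) : lam *: (lam^-1 *: x) = x by rewrite scalerA divff ?scale1r.
split; rewrite koszul1E -/(@Vol C X) ?(b1_de1 XB) ?(b1_de2 XB) ?perp_e_mull
  ?perp_mull ?perp0l ?perp0r ?(perp_e1e1 P) ?(perp_e1e2 P) ?(perp_e2e1 P)
  ?(perp_e2e2 P) ?(perp_Vole P) ?(perp_eVol P) ?(b1_e1e1 XB) ?(b1_e2e2 XB)
  ?(e2e1 XB) ?dN ?dZ ?dP ?(d_alg XB) ?d0 ?dd0 ?addr0.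
- by rewrite sub0r (mod_delta_e1 M) (b1_central XB) addNr.
- rewrite (mod_delta_Vol M) (mod_delta_e1 M) (mod_delta_e2 M) -(b1_central XB).
  rewrite b0 b1 !emb_e1 !emb_e2 e1_oneform.
  rewrite !(oneformZ, oneformN, oneform_mull, oneformD).
  congr oneform; lin3_solve.
- rewrite (mod_delta_Vol M) (mod_delta_e1 M) (mod_delta_e2 M).
  rewrite -(b1_central XB) b0 b1 !emb_e1 !emb_e2 e1_oneform.
  rewrite !(oneformZ, oneformN, oneform_mull, oneformD).
  congr oneform; lin3_solve.
- rewrite (mod_delta_Vol M) (mod_delta_e2 M) -(b1_central XB) addrNK mulrN.
  rewrite addrNK b0 b1 !emb_e1 !emb_e2 !(oneformZ, oneformN, oneformD).
  congr oneform; lin3_solve.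
Qed.

Lemma cf1_nabla_along_e i j p :
  cf1 (nabla_along perp delta (e i) (e j)) p = christoffel i j p.
Proof.
have [K00 K01 K10 K11] := koszul_basis.
rewrite /nabla_along (cf1Z XB).
move: i j p; apply: ord2_ind; apply: ord2_ind; apply: ord2_ind;
  rewrite ?K00 ?K01 ?K10 ?K11 ?(cf1D XB) ?(cf1N XB) ?(cf1_mull XB) ?(cf1_0 XB)
    ?(cf1_e XB) /christoffel /=
    ?(mulr0, mulr1, scaler0, scalerN, oppr0, addr0, add0r) //.
Qed.

Lemma perpNl w h : perp (- w) h = - perp w h.
Proof. by rewrite -scaleN1r perpZl scaleN1r. Qed.

Lemma perpNr w h : perp w (- h) = - perp w h.
Proof. by rewrite -scaleN1r perpZr scaleN1r. Qed.

(* The terms of the Koszul bracket that come from the failure of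
   left A-linearity of its ingredients, apart from the one in perpR. *)
Lemma koszul_anomaly w i j : hdeg 1 w ->
  perp w (e i * e j) - perp w (e i) * e j + e i * perp w (e j)
  + perp (e i) (w * e j) + perp (e i * w + w * e i) (e j)
  + w * perp (e i) (e j) = perp (e i) w * e j.
Proof.
(* The difference of the two sides is additive and, by centrality of the basis, left A-linear in w;
   so it vanishes once it does on e_1 and e_2. *)
pose F u := perp u (e i * e j) - perp u (e i) * e j + e i * perp u (e j)
  + perp (e i) (u * e j) + perp (e i * u + u * e i) (e j)
  + u * perp (e i) (e j) - perp (e i) u * e j.
have FD u u' : F (u + u') = F u + F u'.
  rewrite /F !perpDl !(mulrDl, mulrDr) !perpDr !perpDl !mulrDl !opprD.
  rewrite !addrA.
  by rewrite [LHS](ACl (1*3*5*7*9*11*13*15*2*4*6*8*10*12*14*16))%AC.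
have FZ x u : F (emb x * u) = emb x * F u.
  rewrite /F !perp_mull -!mulrA !perp_e_mull.
  have ex z : e i * (emb x * z) = emb x * (e i * z).
    by rewrite mulrA -(b1_central XB) mulrA.
  rewrite !ex.
  by rewrite -(mulrDr (emb x)) perp_mull -!mulrA !mulrDr !mulrN.
have pVV p : perp (- lam *: Vol + - lam *: Vol) (e p) = - (2 * lam * b) *: e p.
  by rewrite -scalerDl perpZl (perp_Vole P) scalerA; congr (_ *: _); ring.
suff F0 p : F (e p) = 0.
  by move=> [x [y ->]]; apply: subr0_eq; rewrite -/(F _) FD !FZ !F0 !mulr0 addr0.
rewrite /F {F FD FZ}; move: i j p.
apply: ord2_ind; apply: ord2_ind; apply: ord2_ind.
all: rewrite -/(@Vol C X) ?(b1_e1e1 XB) ?(b1_e2e2 XB) ?(e2e1 XB)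
  ?addrN ?addNr ?perp0r ?perp0l ?pVV ?perpNr ?perpNl ?perpZr ?perpZl
  ?(perp_e1e1 P) ?(perp_e1e2 P) ?(perp_e2e1 P) ?(perp_e2e2 P)
  ?(perp_Vole P) ?(perp_eVol P) ?mulrN ?mulNr ?mulr_algr ?mulr_algl
  ?mulr0 ?mul0r ?scaler0 ?oppr0 ?addr0 ?add0r ?e1_oneform ?e2_oneform
  ?oneformZ ?oneformN ?oneformD //.
all: rewrite ?perp0l ?addr0 //.
all: rewrite ?(oneformZ, oneformN, oneformD) -[RHS]oneform0.
all: congr oneform; lin3_solve.
Qed.

End Koszul.

(** * Left connections determined by their values on e_1 and e_2 *)

Section Extension.
Variables (C : numClosedFieldType) (X : calculus C) (lam : C).
Hypothesis XB : beta1 X lam.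
Implicit Types (a : Alg X) (w h : Om X) (i j p q : 'I_2).

Lemma tens_e w j i p : tens w (e j) i p = cf1 w i * (j == p)%:R.
Proof. by rewrite mxE (cf1_e XB). Qed.

(** On 1-forms the left Leibniz rule forces this formula for a connection taking e_j to [N j]. *)
Definition extend (N : 'I_2 -> 'M[Alg X]_2) h : 'M[Alg X]_2 :=
  \sum_j (tens (dd (emb (cf1 h j))) (e j) + cf1 h j *: N j).

Lemma extend_e N i : extend N (e i) = N i.
Proof.
have d0 : dd (emb 0 : Om X) = 0 by rewrite !linear0.
have d1 : dd (emb 1 : Om X) = 0 by rewrite -(scale1r 1) emb_alg (d_alg XB).
have t0 j : tens 0 (e j) = 0 :> 'M[Alg X]_2.
  by apply/matrixP=> p q; rewrite tens_e (cf1_0 XB) mul0r mxE.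
rewrite /extend sum_ord2 !(cf1_e XB); move: i; apply: ord2_ind => /=;
by rewrite d0 d1 !t0 scale0r scale1r !add0r ?addr0.
Qed.

Lemma extend_left_connection N : left_connection (extend N).
Proof.
split=> [w h _ _|a h _]; rewrite /extend; apply/matrixP=> i p.
  rewrite -big_split !summxE; apply: eq_bigr => j _.
  rewrite !mxE !(cf1D XB) rmorphD linearD /= (cf1D XB) !mulrDl.
  by rewrite addrACA.
rewrite scaler_sumr mxE !summxE [tens _ _ _ _]mxE.
have -> : cf1 (dd (emb a)) i * cf1 h p =
    \sum_j cf1 (dd (emb a)) i * cf1 h j * (j == p)%:R.
  by rewrite sum_ord2; move: p; apply: ord2_ind;
    rewrite /= ?mulr1 ?mulr0 ?addr0 ?add0r.
rewrite -big_split; apply: eq_bigr => j _ /=.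
rewrite !mxE (cf1_mull XB) (dembM XB) (cf1D XB) (cf1_mull XB) (cf1_mulr XB).
by rewrite (cf1_e XB) mulrDl mulrDr !mulrA addrA.
Qed.

Lemma left_connection_of_basis (nab : Om X -> 'M[Alg X]_2) :
  (forall h, hdeg 1 h -> nab h = extend (fun i => nab (e i)) h) ->
  left_connection nab.
Proof.
move=> nabE; have [eD eM] := extend_left_connection (fun i => nab (e i)).
split=> [w h w1 h1|a h h1]; first by rewrite !nabE ?eD //; apply: hdegD.
by rewrite !nabE ?eM //; apply: hdeg_mull.
Qed.

End Extension.

(** * The left Leibniz rule of the Koszul connection *)

Section Leibniz.
Variables (C : numClosedFieldType) (X : calculus C) (lam b : C).
Variables (perp perpR : Om X -> Om X -> Om X) (delta : {linear Om X -> Om X}).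
Variables (g v : 'M[C]_2) (k l : 'I_2 -> C).
Hypothesis XB : beta1 X lam.
Hypothesis lam0 : lam != 0.
Hypothesis M : in_moduli perp perpR delta lam b g v k l.
Implicit Types (a : Alg X) (w h : Om X) (i j p q : 'I_2).

Let nabla := nabla perp delta g.

Lemma jj_demb i a : jj perp perpR (e i) (dd (emb a)) =
  emb (\sum_p g i p *: cf1 (dd (emb a)) p).
Proof.
have jD w w' : hdeg 1 w -> hdeg 1 w' ->
    jj perp perpR (e i) (w + w') = jj perp perpR (e i) w + jj perp perpR (e i) w'.
  move=> w1 w'1; rewrite /jj (perpDr M) (bm2_addr (rc_bimod (mod_reg M))) //.
  by rewrite addrACA scalerDr.
have jM x p : jj perp perpR (e i) (emb x * e p) = emb (g i p *: x).
  rewrite (b1_central XB) /jj (perp_mulr M).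
  rewrite (bm2_right (rc_bimod (mod_reg M))); last exact: hdeg_e.
  by rewrite -mulrDl scalerAl -/(jj _ _ _ _) (mod_jg M) mulr_algl linearZ.
rewrite {1}(demb XB) jD ?jM ?sum_ord2 ?rmorphD //.

all: by apply: hdeg_mull; apply: hdeg_e.
Qed.

(** Each of the six terms of the bracket deviates from left A-linearity by terms in da. Those with
    [perp] add up to a single one by [koszul_anomaly]; together with the one in [perpR] it is twice
    [jj (e i) (dd (emb a))], times e_j. *)
Lemma koszul_mull i a j : koszul perp delta 1 (e i) (emb a * e j) =
  emb a * koszul perp delta 1 (e i) (e j)
  + (perp (e i) (dd (emb a)) + perpR (e i) (dd (emb a))) * e j.
Proof.
have R := mod_reg M.
have dl x w : delta (emb x * w) = emb x * delta w + perp (dd (emb x)) w.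
  by apply/eqP; rewrite addrC -subr_eq (rc_left R).
(* Both product rules of delta are applied to a e_i = e_i a; this is where [perpR] enters. *)
have de_r : delta (e i) * emb a = emb a * delta (e i)
    + (perp (dd (emb a)) (e i) - perpR (e i) (dd (emb a))).
  have := rc_right R a (e i); rewrite -(b1_central XB) dl => <-.
  by rewrite opprB addrA addrC addrNK.
have dde_r : dd (e i) * emb a =
    emb a * dd (e i) + (e i * dd (emb a) + dd (emb a) * e i).
  have := b1_leibniz XB (emb a) (hdeg_e X i).
  rewrite expr1 scaleN1r -(b1_central XB) (d_mull XB) => E.
  by rewrite addrCA [emb a * _ + _]addrC E addrC addrNK.
have swap z : e i * (emb a * z) = emb a * (e i * z).
  by rewrite mulrA -(b1_central XB) mulrA.
have t1 : delta (e i * (emb a * e j)) =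
    emb a * delta (e i * e j) + perp (dd (emb a)) (e i * e j).
  by rewrite swap dl.
have t2 : delta (e i) * (emb a * e j) = emb a * (delta (e i) * e j)
    + (perp (dd (emb a)) (e i) * e j - perpR (e i) (dd (emb a)) * e j).
  by rewrite mulrA de_r mulrDl mulrBl mulrA.
have t3 : e i * delta (emb a * e j) =
    emb a * (e i * delta (e j)) + e i * perp (dd (emb a)) (e j).
  by rewrite dl mulrDr swap.
have t4 : perp (e i) (dd (emb a * e j)) =
    emb a * perp (e i) (dd (e j)) + perp (e i) (dd (emb a) * e j).
  by rewrite (d_mull XB) (perpDr M) (perp_e_mull XB M) addrC.
have t5 : perp (dd (e i)) (emb a * e j) = emb a * perp (dd (e i)) (e j)
    + perp (e i * dd (emb a) + dd (emb a) * e i) (e j).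
  by rewrite -(bm2_bal (perp_bimod (mod_perp M))) // dde_r (perpDl M) (perp_mull M).
have t6 : dd (perp (e i) (emb a * e j)) =
    emb a * dd (perp (e i) (e j)) + dd (emb a) * perp (e i) (e j).
  by rewrite (perp_e_mull XB M) (d_mull XB) addrC.
rewrite !koszul1E t1 t2 t3 t4 t5 t6 [in RHS]mulrDl.
rewrite -(koszul_anomaly XB M _ _ (hdeg_demb XB a)) !mulrDr !mulrN !opprD opprK.
rewrite !addrA.
by rewrite [LHS](ACl (1*3*6*8*10*12*2*4*7*9*11*13*5))%AC.
Qed.

Lemma nabla_along_mull i a j p :
  cf1 (nabla_along perp delta (e i) (emb a * e j)) p =
  a * cf1 (nabla_along perp delta (e i) (e j)) p
  + (\sum_q g i q *: cf1 (dd (emb a)) q) * (j == p)%:R.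
Proof.
rewrite /nabla_along koszul_mull scalerDr scalerAr (cf1D XB) (cf1_mull XB).
by rewrite scalerAl -/(jj _ _ _ _) jj_demb (cf1_mull XB) (cf1_e XB).
Qed.

Lemma nablaE h i p :
  nabla h i p = \sum_j invmx g i j *: cf1 (nabla_along perp delta (e j) h) p.
Proof.
rewrite /nabla /Defs.nabla !sum_ord2 !mxE !(cf1Z XB) !(cf1_e XB).
move: i; apply: ord2_ind => /=; rewrite !(scaler0, mul0r, addr0, add0r);
by rewrite -!scalerAl !mul1r.
Qed.

Lemma nablaD w h : nabla (w + h) = nabla w + nabla h.
Proof.
apply/matrixP=> i p; rewrite mxE !nablaE -big_split /=; apply: eq_bigr => j _.
rewrite -scalerDr -(cf1D XB) /nabla_along -scalerDr; congr (_ *: cf1 (_ *: _) p).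
rewrite !koszul1E !mulrDr !linearD /= !mulrDr !(perpDr M) linearD /= ?opprD.
rewrite !addrA.
by rewrite [LHS](ACl (1*3*5*7*9*11*2*4*6*8*10*12))%AC.
Qed.

(** Along e_i the derivative term is sum_q g^{iq} (da)_q; contracting with the inverse matrix g_{ij}
    returns da itself. *)
Lemma nabla_mull_e a j :
  nabla (emb a * e j) = tens (dd (emb a)) (e j) + a *: nabla (e j).
Proof.
apply/matrixP=> i p; rewrite nablaE [RHS]mxE (tens_e XB) [X in _ + X]mxE nablaE.
under eq_bigr do rewrite nabla_along_mull scalerDr.
rewrite big_split /= addrC; congr (_ + _); last first.
  by rewrite mulr_sumr; apply: eq_bigr => q _; rewrite scalerAr.
under eq_bigr do rewrite scalerAl.
rewrite -mulr_suml; congr (_ * _).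
under eq_bigr do rewrite scaler_sumr.
under eq_bigr do under eq_bigr do rewrite scalerA.
rewrite exchange_big /=.
under eq_bigr do rewrite -scaler_suml.
have E q : \sum_s invmx g i s * g s q = (i == q)%:R.
  by move/matrixP: (mulVmx (mod_unit M)) => /(_ i q); rewrite !mxE.
under eq_bigr do rewrite E.
rewrite sum_ord2; move: i {E}; apply: ord2_ind;
  by rewrite /= !(scale0r, scale1r, addr0, add0r).
Qed.

Lemma nabla_left_connection : left_connection nabla.
Proof.
apply: (left_connection_of_basis XB) => h /(hdeg1_sum XB) {1}->.
by rewrite nablaD !nabla_mull_e /extend sum_ord2.
Qed.

Lemma nabla_e i j p :
  nabla (e i) j p = \sum_q invmx g j q *: christoffel X lam g k q i p.
Proof.
by rewrite nablaE; apply: eq_bigr => q _; rewrite (cf1_nabla_along_e XB lam0 M).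
Qed.

End Leibniz.

(** * Commutators in A as partial derivatives *)

Section Commutators.
Variables (C : numClosedFieldType) (X : calculus C) (lam : C).
Hypothesis XB : beta1 X lam.
Implicit Types (a : Alg X) (w h : Om X) (i j p q : 'I_2).

Let rV : gr * grV = 1 :> Alg X := rt_rV (rtp_rel (b1_alg XB)).
Let Vr : grV * gr = 1 :> Alg X := rt_Vr (rtp_rel (b1_alg XB)).

Lemma cf1_dr i : cf1 (dd (emb gr) : Om X) i = (0 == i)%:R.
Proof. by rewrite -(cf1_e XB). Qed.

(** Solving e_2 = r dt - t dr for dt gives dt = r^-1 (e_2 + t e_1). *)
Lemma cf1_dt i : cf1 (dd (emb gt) : Om X) i =
  grV * ((1 == i)%:R + gt * (0 == i)%:R).
Proof.
have : cf1 (emb gr * dd (emb gt) - emb gt * dd (emb gr) : Om X) i = (1 == i)%:R.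
  by rewrite -(cf1_e XB).
rewrite (cf1D XB) (cf1N XB) !(cf1_mull XB) cf1_dr => <-.
by rewrite addrNK mulrA Vr mul1r.
Qed.

Lemma cf1_drV i : cf1 (dd (emb grV) : Om X) i = - (grV * (0 == i)%:R * grV).
Proof.
have := dembM XB gr grV; rewrite rV rmorph1 -(scale1r 1) (d_alg XB).
move/(congr1 (fun w => cf1 w i)); rewrite (cf1_0 XB) (cf1D XB) (cf1_mulr XB).
rewrite (cf1_mull XB) cf1_dr => /esym/eqP; rewrite addrC addr_eq0 => /eqP E.
by rewrite -mulrA -mulrN -E mulrA Vr mul1r.
Qed.

Lemma rt_commute : gr * gt = gt * gr + lam *: gr :> Alg X.
Proof. by rewrite -(rt_comm (rtp_rel (b1_alg XB))) addrC addrNK. Qed.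

Lemma t_rV : gt * grV = grV * gt + lam *: grV :> Alg X.
Proof.
have : grV * (gr * gt) * grV = grV * (gt * gr + lam *: gr) * grV :> Alg X.
  by rewrite rt_commute.
rewrite mulrA Vr mul1r mulrDr mulrDl => ->.
by rewrite -!scalerAr -scalerAl Vr mul1r -!mulrA rV mulr1.
Qed.

(* The generators [r^-1 t] and [r^-1] of the span of [lin3] implement the
   partial derivatives of the calculus. *)
Lemma commutator_derivative a i :
  let u := (if i == 0 then grV * gt else grV) in
  a * u - u * a = lam *: cf1 (dd (emb a)) i.
Proof.
move=> u; pose Q x := x * u - u * x = lam *: cf1 (dd (emb x)) i.
(* Both sides are derivations in a, the right one because e_i is central, so the generators
   suffice. *)
apply: (rtp_gen (b1_alg XB) (P := Q)); rewrite {}/Q.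
- by move=> c; rewrite emb_alg (d_alg XB) (cf1_0 XB) mulr_algl mulr_algr
    scaler0 subrr.
- rewrite cf1_dr /u; case: ifP => [/eqP->|].
    rewrite mulrA rV mul1r -mulrA.
    have -> : gt * gr = gr * gt - lam *: gr :> Alg X by rewrite rt_commute addrK.
    by rewrite mulrBr mulrA Vr mul1r opprB addrCA subrr addr0 -scalerAr Vr.
  by rewrite eq_sym => ->; rewrite rV Vr subrr scaler0.
- rewrite cf1_drV /u; case: ifP => [/eqP->|].
    rewrite -mulrA t_rV mulrDr opprD addrA mulrA subrr sub0r -scalerAr eqxx.
    by rewrite mulr1 scalerN.
  by rewrite eq_sym => ->; rewrite subrr mulr0 mul0r oppr0 scaler0.
- rewrite cf1_dt /u; case: ifP => [/eqP->|i0].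
    rewrite /= add0r mulr1 mulrA t_rV mulrDl addrC addrA addNr add0r.
    by rewrite -scalerAl.
  move: i i0 {u}; apply: ord2_ind => //= _.
  by rewrite mulr0 addr0 mulr1 t_rV addrC addrA addNr add0r.
- move=> x y Qx Qy; rewrite rmorphD linearD /= (cf1D XB) scalerDr -Qx -Qy.
  by rewrite mulrDl mulrDr opprD addrACA.
- move=> x y Qx Qy; rewrite (dembM XB) (cf1D XB) (cf1_mull XB) (cf1_mulr XB).
  rewrite scalerDr scalerAl scalerAr -Qx -Qy mulrBl mulrBr !mulrA.
  by rewrite [RHS]addrC addrA addrNK.
Qed.

Lemma commutator_lin3 a x y z : a * lin3 X x y z - lin3 X x y z * a =
  lam *: (x *: cf1 (dd (emb a)) 0 + y *: cf1 (dd (emb a)) 1).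
Proof.
rewrite scalerDr !scalerA ![lam * _]mulrC -!scalerA -(commutator_derivative a 0).
rewrite -(commutator_derivative a 1) /= /lin3 !(mulrDl, mulrDr).
rewrite !scalerBr mulr_algl mulr_algr -!scalerAl -!scalerAr !opprD !addrA.
by rewrite [LHS](ACl (3*6*1*4*2*5))%AC /= subrr add0r.
Qed.

End Commutators.

(** * The generalised braiding and metric compatibility *)

Section Braiding.
Variables (C : numClosedFieldType) (X : calculus C) (lam : C).
Variables (nab : Om X -> 'M[Alg X]_2) (nX nY nZ : 'I_2 -> 'I_2 -> 'I_2 -> C).
Hypothesis XB : beta1 X lam.
Hypothesis nab_conn : left_connection nab.
Hypothesis nabE : forall k i j, nab (e k) i j =
  lin3 X (nX k i j) (nY k i j) (nZ k i j).
Implicit Types (a : Alg X) (w h : Om X) (i j k p q s : 'I_2).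

(* By [commutator_derivative], sigma (e_k (x) e_s) - e_s (x) e_k is lam times
   the matrix of the r^-1 t (s = 0) or r^-1 (s = 1) coefficients of nabla e_k. *)
Definition braid_coef k s p q : C :=
  (p == s)%:R * (k == q)%:R + lam * (if s == 0 then nX k p q else nY k p q).

Definition braid (M : 'M[Alg X]_2) : 'M[Alg X]_2 :=
  \matrix_(p, q) \sum_k \sum_s braid_coef k s p q *: M k s.

(** Since a e_k = e_k a, the left side is an entry of nabla (a e_k) - (nabla e_k) a, the value
    required of sigma (e_k (x) da). By [commutator_lin3] the commutators in it are linear in da with
    constant factors. *)
Lemma braid_leibniz k a p q : cf1 (dd (emb a)) p * (k == q)%:R
    + a * nab (e k) p q - nab (e k) p q * a =
  \sum_s braid_coef k s p q *: cf1 (dd (emb a)) s.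
Proof.
rewrite nabE -addrA (commutator_lin3 XB) sum_ord2 /braid_coef /=.
rewrite !scalerDl scalerDr !scalerA addrACA; congr (_ + _).
rewrite -!scalerA !scaler_nat -mulr_natr.
move: p q k; apply: ord2_ind; apply: ord2_ind; apply: ord2_ind;
by rewrite /= ?(mulr1, mulr0, mulr0n, mulr1n, addr0, add0r).
Qed.

Lemma nab_basis h : hdeg 1 h -> nab h = extend (fun i => nab (e i)) h.
Proof.
move=> /(hdeg1_sum XB) {1}->; rewrite (lc_add nab_conn);
  try by apply: hdeg_mull; apply: hdeg_e.
by rewrite !(lc_leibniz nab_conn) ?/extend ?sum_ord2 //; apply: hdeg_e.
Qed.

(** For the right Leibniz rule at h = sum_k h_k e_k, expand d(h_k a) = (d h_k) a + h_k da: the first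
    term belongs to (nabla h) a, and the second is covered by [braid_leibniz]. *)
Lemma braid_generalised : generalised_braiding nab braid.
Proof.
split=> [M N|a M|M a|a h h1].
- apply/matrixP=> p q; rewrite !mxE -big_split; apply: eq_bigr => k _ /=.
  by rewrite -big_split; apply: eq_bigr => s _; rewrite mxE scalerDr.
- apply/matrixP=> p q; rewrite !mxE mulr_sumr; apply: eq_bigr => k _.
  by rewrite mulr_sumr; apply: eq_bigr => s _; rewrite mxE scalerAr.
- apply/matrixP=> p q; rewrite !mxE mulr_suml; apply: eq_bigr => k _.
  by rewrite mulr_suml; apply: eq_bigr => s _; rewrite mxE scalerAl.
have ha1 : hdeg 1 (h * emb a).
  move: h1 => [x [y ->]]; exists (x * a), (y * a).
  by rewrite mulrDl -!mulrA -!(b1_central XB) !mulrA !rmorphM.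
rewrite !nab_basis // /extend; apply/matrixP=> p q.
rewrite [RHS]mxE [X in X + _]mxE [X in _ + X]mxE !summxE mulr_suml -big_split.
apply: eq_bigr => k _ /=.
under [in RHS]eq_bigr do rewrite mxE scalerAr.
rewrite -mulr_sumr -braid_leibniz !mxE (cf1_mulr XB) (dembM XB) (cf1D XB).
rewrite (cf1_mull XB) (cf1_mulr XB) (cf1_e XB).
set x := cf1 (dd (emb (cf1 h k))) p; set y := cf1 _ p; set c := cf1 h k.
rewrite !(mulrDl, mulrDr, mulrN) !mulrA.
have -> : x * (k == q)%:R * a = x * a * (k == q)%:R.
  by case: (k == q); rewrite ?mulr1 // !mulr0 mul0r.
rewrite !addrA.
by rewrite [RHS](ACl (1*3*4*(2*5)))%AC /= addrN addr0.
Qed.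

(** The right Leibniz rule at a = r gives sigma on e_k (x) e_1. At a = t it gives sigma on e_k (x)
    dt, hence on e_k (x) e_2, because the e_2 coefficient r^-1 of dt is invertible. *)
Lemma braiding_unique sigma : generalised_braiding nab sigma ->
  forall M p q, sigma M p q = braid M p q.
Proof.
move=> [sD sZ sR sL] M p q.
have key k a : \sum_s cf1 (dd (emb a)) s * sigma (delta_mx k s) p q =
    \sum_s braid_coef k s p q *: cf1 (dd (emb a)) s.
  rewrite -braid_leibniz; have := sL a (e k) (hdeg_e X k).
  rewrite -(b1_central XB) (lc_leibniz nab_conn) ?hdeg_e //; last exact: hdeg_e.
  move/matrixP/(_ p q); rewrite [LHS]mxE [RHS]mxE (tens_e XB) [X in _ + X = _]mxE.
  rewrite [X in _ = X + _]mxE => ->; rewrite addrC addKr.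
  have -> : tens (e k) (dd (emb a)) = \sum_s cf1 (dd (emb a)) s *: delta_mx k s.
    apply/matrixP=> i j; rewrite sum_ord2 !mxE (cf1_e XB) eq_sym.
    move: j k i {sL}; apply: ord2_ind; apply: ord2_ind; apply: ord2_ind;
    by rewrite /= ?(mulr1, mul1r, mulr0, mul0r, addr0, add0r).
  by rewrite !sum_ord2 sD !sZ !mxE.
have S0 k : sigma (delta_mx k 0) p q = (braid_coef k 0 p q)%:A.
  have := key k gr; rewrite !sum_ord2 !(cf1_dr XB) /=.
  by rewrite mul1r mul0r scaler0 !addr0.
have S1 k : sigma (delta_mx k 1) p q = (braid_coef k 1 p q)%:A.
  have := key k gt; rewrite !sum_ord2 S0 mulr_algr => /addrI.
  rewrite (cf1_dt XB) /= mulr0 addr0 mulr1 => /(congr1 ( *%R gr)).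
  by rewrite mulrA -scalerAr (rt_rV (rtp_rel (b1_alg XB))) mul1r.
rewrite {1}(matrix_sum_delta M) !sum_ord2 !sD !mxE.
have sc c N : sigma (c *: N) p q = c * sigma N p q by rewrite sZ mxE.
by rewrite !sum_ord2 !sc !S0 !S1 !mulr_algr.
Qed.

(** Uniqueness of sigma removes the existential quantifier. *)
Lemma metric_compatibleE (m : 'M[Alg X]_2) : metric_compatible nab m <->
  forall p q j, nabla_id nab m p q j + sigma_id_nabla nab braid m p q j = 0.
Proof.
split=> [[sigma [sB sM]] p q j|mc]; last first.
  by exists braid; split=> //; apply: braid_generalised.
by rewrite -[RHS](sM p q j); congr (_ + _); rewrite /sigma_id_nabla braiding_unique.
Qed.

End Braiding.

(** * Torsion and cotorsion *)

Section Torsion.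
Variables (C : numClosedFieldType) (X : calculus C) (lam : C).
Variables (nab : Om X -> 'M[Alg X]_2) (g : 'M[C]_2) (k : 'I_2 -> C).
Hypothesis XB : beta1 X lam.
Hypothesis ug : g \in unitmx.
Implicit Types (a : Alg X) (w h : Om X) (i j p q : 'I_2).

(** The value of nabla on e_i, written without delta and so available at lam = 0: one computation of
    torsion and cotorsion serves the quantum and the classical connection. *)
Definition koszul_mx i : 'M[Alg X]_2 :=
  \matrix_(j, p) \sum_q invmx g j q *: christoffel X lam g k q i p.

(** Linear in [a]: the families 2 g^{q1}, 2 g^{q2} and k_q yield the coefficients of r^-1 t, r^-1
    and 1 in an entry of [koszul_mx]. *)
Definition koszul_coef (a : 'I_2 -> C) i j p : C :=
  let c q := invmx g j q / 2 in
  if i == 0 then (if p == 0 then c 1 * a 0 else 0)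
  else if p == 0 then - (c 0 * a 0) + c 1 * (a 1 + lam * a 0)
  else - (c 1 * a 0).

Lemma koszul_mxE i j p : koszul_mx i j p =
  lin3 X (koszul_coef (fun q => 2 * g q 0) i j p)
         (koszul_coef (fun q => 2 * g q 1) i j p) (koszul_coef k i j p).
Proof.
have two : (2 : C) != 0 by rewrite pnatr_eq0.
rewrite mxE sum_ord2 /koszul_coef /christoffel.
move: i p; apply: ord2_ind; apply: ord2_ind; lin3_solve.
Qed.

Definition wedge_coef i j : C :=
  if i == 0 then (j == 1)%:R else if j == 0 then -1 else - lam.

Lemma cf2_wedge i j : cf2 (e i * e j : Om X) = (wedge_coef i j)%:A.
Proof.
move: i j; apply: ord2_ind; apply: ord2_ind; rewrite /wedge_coef /=.
- by rewrite (b1_e1e1 XB) -(scale0r (1 : Om X)) (cf2Z XB) !scale0r.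
- by rewrite -/(@Vol C X) (cf2_Vol XB) scale1r.
- by rewrite (e2e1 XB) (cf2N XB) (cf2_Vol XB) scaleN1r.
- by rewrite (b1_e2e2 XB) (cf2Z XB) (cf2_Vol XB).
Qed.

Lemma cf2_wedgeM a i j : cf2 (emb a * e i * e j) = wedge_coef i j *: a.
Proof. by rewrite -mulrA (cf2_mull XB) cf2_wedge mulr_algr. Qed.

Lemma cf2_de i : cf2 (dd (e i) : Om X) = (i == 1)%:R *: (2 *: grV).
Proof.
move: i; apply: ord2_ind => /=.
  by rewrite (b1_de1 XB) -(scale0r (1 : Om X)) (cf2Z XB) !scale0r.
by rewrite (b1_de2 XB) (cf2_mull XB) (cf2_Vol XB) mulr1 scale1r.
Qed.

Lemma torsionE i : torsion nab i =
  \sum_p \sum_q wedge_coef p q *: nab (e i) p q - (i == 1)%:R *: (2 *: grV).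
Proof.
rewrite /torsion (cf2D XB) (cf2N XB) cf2_de; congr (_ - _).
by rewrite /wedge !sum_ord2 !(cf2D XB) !cf2_wedgeM.
Qed.

Lemma cotorsionE j : cotorsion nab (metric g) j = invmx g 1 j *: (2 *: grV)
  - \sum_i \sum_q \sum_p (invmx g i q * wedge_coef i p) *: nab (e q) p j.
Proof.
have dm c i : cf2 (dd (emb (c%:A : Alg X) * e i)) =
      c *: ((i == 1)%:R *: (2 *: grV)).
  by rewrite emb_alg mulr_algl linearZ /= (cf2Z XB) cf2_de.
have wm c a i p : cf2 (emb (c%:A : Alg X) * e i * (emb a * e p)) =
    (c * wedge_coef i p) *: a.
  rewrite mulrA -(mulrA _ _ (emb a)) -(b1_central XB) mulrA -rmorphM cf2_wedgeM.
  by rewrite mulr_algl scalerA mulrC.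
rewrite /cotorsion /metric (cf2D XB) (cf2N XB); congr (_ - _).
  by rewrite !sum_ord2 !mxE (cf2D XB) !dm /= scale0r scaler0 add0r scale1r.
by rewrite !sum_ord2 !mxE !(cf2D XB) !wm.
Qed.

Hypothesis nabE : forall i, nab (e i) = koszul_mx i.

Let D0 : \det g != 0.
Proof. by rewrite -unitfE -[_ \is a _]unitmxE. Qed.

Lemma torsion_koszul i : torsion nab i =
  if i == 0 then (g 0 0 * \det g) *: cored lam g k 1
  else - (\det g *: (g 0 0 *: cored lam g k 0
           + (g 0 1 - g 1 0 + lam * g 0 0) *: cored lam g k 1)) - 2 *: grV.
Proof.
have two : (2 : C) != 0 by rewrite pnatr_eq0.
have [h00 h01 h10 h11] := invmx2E ug.
have D0' := D0; have DE := det_mx2 g.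
rewrite torsionE !nabE !sum_ord2 !koszul_mxE /wedge_coef /koszul_coef /cored.
rewrite h00 h01 h10 h11; move: D0'; rewrite DE => D0'.
move: i; apply: ord2_ind; rewrite /= ?(scale0r, scale1r); lin3_solve.
Qed.

(** At lam = 0 only the classical cotorsion is left; for lam != 0 the second term identifies
    (g^{11})^2 times [cored] as the difference quotient (C_i - C_i^cl) / lam. *)
Lemma cotorsion_koszul i : cotorsion nab (metric g) i =
  cotorsion_cl g k i + (lam * g 0 0 ^+ 2) *: cored lam g k i.
Proof.
have two : (2 : C) != 0 by rewrite pnatr_eq0.
have [h00 h01 h10 h11] := invmx2E ug.
have D0' := D0; have DE := det_mx2 g.
rewrite cotorsionE !sum_ord2 !nabE !koszul_mxE /wedge_coef /koszul_coef /cored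
  /cotorsion_cl.
rewrite h00 h01 h10 h11; move: D0'; rewrite DE => D0'.
move: i; apply: ord2_ind; rewrite ?h10 ?h11 ?DE /= ?(scale0r, scale1r); lin3_solve.
Qed.

End Torsion.

(** * The connection in terms of the reduced cotorsion *)

Section CotorsionForm.
Variables (C : numClosedFieldType) (X : calculus C) (lam : C).
Variables (g : 'M[C]_2) (k : 'I_2 -> C).
Hypothesis ug : g \in unitmx.

Let D0 : \det g != 0.
Proof. by rewrite -unitfE -[_ \is a _]unitmxE. Qed.

Let e11 := delta_mx 0 0 : 'M[Alg X]_2.
Let e12 := delta_mx 0 1 : 'M[Alg X]_2.
Let e21 := delta_mx 1 0 : 'M[Alg X]_2.
Let e22 := delta_mx 1 1 : 'M[Alg X]_2.
Let U := cored lam g k : 'I_2 -> Alg X.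
Let D := \det g.

Lemma koszul_mx0_cored : koszul_mx X lam g k 0 =
  (g 0 1 * D *: U 1) *: e11 - (g 0 0 * D *: U 1) *: e21.
Proof.
have two : (2 : C) != 0 by rewrite pnatr_eq0.
have [h00 h01 h10 h11] := invmx2E ug.
have D0' := D0; have DE := det_mx2 g.
apply/matrixP=> i p; rewrite koszul_mxE /U /D /cored /koszul_coef !mxE.
move: D0'; rewrite DE => D0'.
move: i p; apply: ord2_ind; apply: ord2_ind;
  rewrite ?h00 ?h01 ?h10 ?h11 ?DE /=; lin3_solve.
Qed.

Lemma koszul_mx1_cored : koszul_mx X lam g k 1 =
  - ((D *: (g 0 1 *: U 0 - g 1 1 *: U 1)) *: e11)
  - (g 0 1 * D *: U 1) *: e12
  + (D *: (g 0 0 *: U 0 - g 1 0 *: U 1)) *: e21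
  + (g 0 0 * D *: U 1) *: e22.
Proof.
have two : (2 : C) != 0 by rewrite pnatr_eq0.
have [h00 h01 h10 h11] := invmx2E ug.
have D0' := D0; have DE := det_mx2 g.
apply/matrixP=> i p; rewrite koszul_mxE /U /D /cored /koszul_coef !mxE.
move: D0'; rewrite DE => D0'.
move: i p; apply: ord2_ind; apply: ord2_ind;
  rewrite ?h00 ?h01 ?h10 ?h11 ?DE /=; lin3_solve.
Qed.

(** The right side is that of [torsion_koszul] at lam = 0; the summand [0 * g 0 0] is kept so that
    the two agree literally. *)
Lemma torsion_cl_cored i : torsion_cl (X := X) g k i =
  if i == 0 then (g 0 0 * D) *: cored 0 g k 1
  else - (D *: (g 0 0 *: cored 0 g k 0
           + (g 0 1 - g 1 0 + 0 * g 0 0) *: cored 0 g k 1)) - 2 *: grV.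
Proof.
have two : (2 : C) != 0 by rewrite pnatr_eq0.
have D0' := D0; have DE := det_mx2 g.
rewrite /torsion_cl /D /cored; move: D0'; rewrite DE => D0'.
move: i; apply: ord2_ind; rewrite /=; lin3_solve.
Qed.

End CotorsionForm.

(** * Vanishing cotorsion and the Levi-Civita condition *)

Section LeviCivita.
Variables (C : numClosedFieldType) (X : calculus C) (lam : C).
Variables (nab : Om X -> 'M[Alg X]_2) (g : 'M[C]_2) (k : 'I_2 -> C).
Hypothesis XB : beta1 X lam.
Hypothesis lam0 : lam != 0.
Hypothesis ug : g \in unitmx.
Hypothesis nab_conn : left_connection nab.
Hypothesis nabE : forall i, nab (e i) = koszul_mx X lam g k i.

Lemma alg_inj (c : C) : c%:A = 0 :> Alg X -> c = 0.
Proof. by move/eqP; rewrite scaler_eq0 oner_eq0 orbF => /eqP. Qed.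

(** A vanishing element has vanishing commutators; divided by lam, the commutator with r leaves x,
    and after that the one with t leaves r^-1 y. *)
Lemma lin3_eq0 x y z : lin3 X x y z = 0 -> [/\ x = 0, y = 0 & z = 0].
Proof.
move=> E.
have comm0 a : x *: cf1 (dd (emb a) : Om X) 0 + y *: cf1 (dd (emb a)) 1 = 0.
  apply: (scalerI lam0); rewrite scaler0 -(commutator_lin3 XB a x y z) E.
  by rewrite mulr0 mul0r subr0.
have x0 : x = 0.
  by apply: alg_inj; have := comm0 gr; rewrite !(cf1_dr XB) scaler0 addr0.
have y0 : y = 0.
  have := comm0 gt; rewrite x0 scale0r add0r (cf1_dt XB) /= mulr0 addr0 mulr1.
  move/(congr1 ( *%R gr)); rewrite mulr0 -scalerAr.
  by rewrite (rt_rV (rtp_rel (b1_alg XB))); apply: alg_inj.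
by split=> //; apply: alg_inj; rewrite -E /lin3 x0 y0 !scale0r !add0r.
Qed.

Let D0 : \det g != 0.
Proof. by rewrite -unitfE -[_ \is a _]unitmxE. Qed.

Definition weak_lc_params := [/\ g 0 0 = 0, g 0 1 + g 1 0 = 0 & k 0 = 0].

Lemma weak_lc_det : weak_lc_params ->
  [/\ g 1 0 = - g 0 1, \det g = g 0 1 ^+ 2 & g 0 1 != 0].
Proof.
move=> [g00 /eqP + _]; rewrite addrC addr_eq0 => /eqP g10.
have DE : \det g = g 0 1 ^+ 2 by rewrite det_mx2 g00 g10; ring.
by split=> //; move: D0; rewrite DE expf_eq0.
Qed.

Lemma cotorsion_eq0 :
  (cotorsion nab (metric g) 0 = 0 /\ cotorsion nab (metric g) 1 = 0)
  <-> weak_lc_params.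
Proof.
have two : (2 : C) != 0 by rewrite pnatr_eq0.
rewrite !(cotorsion_koszul XB ug nabE) /cotorsion_cl /cored /=.
split=> [[]|wl]; last first.
  by have [g00 g01 k0] := wl; rewrite g00 k0 g01; split; lin3_solve.
rewrite !lin3E => /lin3_eq0[E1 E2 E3] /lin3_eq0[E4 _ _].
have D0' := D0.
have g00 : g 0 0 = 0.
  (* The coefficient of r^-1 t in C_2 is - lam (g^{11})^3 / |g|^2, which forces g^{11} = 0. The r^-1
     and constant coefficients of C_1 then give the other two conditions. *)
  have : - (lam / \det g ^+ 2) * g 0 0 ^+ 3 = 0 by rewrite -[RHS]E4; field.
  move/eqP; rewrite mulf_eq0 oppr_eq0 mulf_eq0 invr_eq0 !expf_eq0 /= (negPf lam0).
  by rewrite (negPf D0') => /eqP.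
have nz : - (2 / \det g) != 0 by rewrite oppr_eq0 mulf_neq0 ?invr_eq0.
split=> //; apply: (mulfI nz); rewrite mulr0.
  by rewrite -[RHS]E2 g00; field.
by rewrite -[RHS](mulr0 2) -E3 g00; field.
Qed.

(** T_1 has the factor g^{11}. In T_2, with |g| = (g^{12})^2 and k_1 = 0, the wedge of nabla e_2 is
    (2/r) Vol, which is d e_2. *)
Lemma torsion_eq0 : weak_lc_params -> torsion nab 0 = 0 /\ torsion nab 1 = 0.
Proof.
have two : (2 : C) != 0 by rewrite pnatr_eq0.
move=> wl; have [g00 g01 k0] := wl; have [g10 DE x0] := weak_lc_det wl.
rewrite !(torsion_koszul XB ug nabE) /cored /= DE g10 g00 k0.
split; first by rewrite mul0r scale0r.
lin3_solve.
Qed.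

(** The eight components of the condition lie in the span [lin3]. The component of e_1 (x) e_1 (x)
    e_1 already determines g^{22}, and its value solves the others. It is - lam g^{12}, where the
    English statement has half of this. *)
Lemma metric_compatible_koszul : weak_lc_params ->
  metric_compatible nab (metric g) <-> g 1 1 = - (lam * g 0 1).
Proof.
have two : (2 : C) != 0 by rewrite pnatr_eq0.
move=> wl; have [g00 g01 k0] := wl; have [g10 DE x0] := weak_lc_det wl.
have [h00 h01 h10 h11] := invmx2E ug; rewrite DE ?g00 ?g10 in h00 h01 h10 h11.
have nabL i p q : nab (e i) p q = lin3 X
    (koszul_coef lam g (fun q => 2 * g q 0) i p q)
    (koszul_coef lam g (fun q => 2 * g q 1) i p q)
    (koszul_coef lam g k i p q).
  by rewrite nabE koszul_mxE.
rewrite (metric_compatibleE XB nab_conn nabL).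
have nabm c i p q : nab (emb (c%:A : Alg X) * e i) p q = c *: nab (e i) p q.
  rewrite (lc_leibniz nab_conn); last exact: hdeg_e.
  by rewrite mxE (tens_e XB) emb_alg (d_alg XB) (cf1_0 XB) mul0r add0r mxE
    mulr_algl.
have idE p q j : nabla_id nab (metric g) p q j =
    \sum_i invmx g i j *: nab (e i) p q.
  by apply: eq_bigr => i _; rewrite mxE nabm.
have sE p q j : sigma_id_nabla nab (braid lam
      (koszul_coef lam g (fun q => 2 * g q 0))
      (koszul_coef lam g (fun q => 2 * g q 1))) (metric g) p q j =
    \sum_i \sum_s braid_coef lam (koszul_coef lam g (fun q => 2 * g q 0))
      (koszul_coef lam g (fun q => 2 * g q 1)) i s p q *:
      (\sum_k invmx g i k *: nab (e k) s j).
  rewrite /sigma_id_nabla mxE; apply: eq_bigr => i _; apply: eq_bigr => s _.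
  by rewrite mxE; congr (_ *: _); apply: eq_bigr => k' _; rewrite mxE mulr_algl.
split=> [/(_ 0 0 0)|g11 p q j]; rewrite idE sE !sum_ord2 !nabL
  /braid_coef /koszul_coef.
  rewrite /= !h00 !h01 !h10 !h11 g00 g10 k0 !lin3E => /lin3_eq0[_ E _].
  (* The r^-1 coefficient of this component is - 2 (g^{22} + lam g^{12}) / (g^{12})^2. *)
  have nz : - (2 / g 0 1 ^+ 2) != 0.
    by rewrite oppr_eq0 mulf_neq0 ?invr_eq0 ?expf_neq0.
  apply/eqP; rewrite -addr_eq0; apply/eqP/(mulfI nz); rewrite mulr0 -[RHS]E.
  by field.
move: p q j; apply: ord2_ind; apply: ord2_ind; apply: ord2_ind;
  rewrite /= ?h00 ?h01 ?h10 ?h11 ?g00 ?g10 ?k0 ?g11; lin3_solve.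
Qed.

Lemma koszul_mx_weak_lc : weak_lc_params -> g 1 1 = - (lam * g 0 1) ->
  koszul_mx X lam g k 0 = - (grV *: delta_mx 0 0) /\
  koszul_mx X lam g k 1 = (grV * gt - (k 1 / (2 * g 0 1))%:A) *: delta_mx 0 0
                          - (g 0 1 *: grV) *: metric g.
Proof.
have two : (2 : C) != 0 by rewrite pnatr_eq0.
move=> wl g11; have [g00 g01 k0] := wl; have [g10 DE x0] := weak_lc_det wl.
have [h00 h01 h10 h11] := invmx2E ug; rewrite DE ?g00 ?g10 ?g11 in h00 h01 h10 h11.
have rt3 : grV * gt = lin3 X 1 0 0.
  by rewrite /lin3 !scale0r scale1r !addr0.
split; apply/matrixP=> i p; rewrite koszul_mxE /koszul_coef !mxE ?mulr_algr ?rt3.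
all: move: i p; apply: ord2_ind; apply: ord2_ind;
  rewrite ?h00 ?h01 ?h10 ?h11 ?g00 ?g10 ?g11 ?k0 /=; lin3_solve.
Qed.

End LeviCivita.

(** * The one-parameter family of codifferentials *)

Section Family.
Variables (C : numClosedFieldType) (X : calculus C) (lam b : C).
Variables (perp perpR : Om X -> Om X -> Om X) (g : 'M[C]_2).
Hypothesis XB : beta1 X lam.
Hypothesis lam0 : lam != 0.
Implicit Types (a : Alg X) (w h : Om X) (i j p q : 'I_2).

Lemma nabla_koszul_mx (delta : {linear Om X -> Om X}) v k l i :
  in_moduli perp perpR delta lam b g v k l ->
  nabla perp delta g (e i) = koszul_mx X lam g k i.
Proof. by move=> M; apply/matrixP=> j p; rewrite mxE (nabla_e XB lam0 M). Qed.

(* A multiple of [shift] added to delta changes only k_2 and l_1. *)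
Definition shift w : Om X := emb (cf1 w 1) - emb (cf2 w) * e 0.

Lemma shiftD w h : shift (w + h) = shift w + shift h.
Proof.
by rewrite /shift (cf1D XB) (cf2D XB) !rmorphD mulrDl opprD addrACA.
Qed.

Lemma shift_mull a w : shift (emb a * w) = emb a * shift w.
Proof. by rewrite /shift (cf1_mull XB) (cf2_mull XB) !rmorphM mulrBr mulrA. Qed.

Lemma shift_mulr a w : shift (w * emb a) = shift w * emb a.
Proof.
rewrite /shift (cf1_mulr XB) (cf2_mulr XB) !rmorphM mulrBl -!mulrA.
by rewrite (b1_central XB).
Qed.

Lemma shiftZ c w : shift (c *: w) = c *: shift w.
Proof. by rewrite -mulr_algl -emb_alg shift_mull emb_alg mulr_algl. Qed.

Lemma shiftN w : shift (- w) = - shift w.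
Proof. by rewrite -scaleN1r shiftZ scaleN1r. Qed.

Lemma shift_linear : linear shift.
Proof. by move=> c w h; rewrite shiftD shiftZ. Qed.

Lemma shift_emb a : shift (emb a) = 0.
Proof.
by rewrite /shift (cf1_emb XB); case: (cf_emb XB a) => _ _ _ ->;
  rewrite !rmorph0 mul0r subr0.
Qed.

Lemma shift0 : shift 0 = 0.
Proof. by rewrite -(rmorph0 emb) shift_emb rmorph0. Qed.

Lemma shift_e1 : shift (e 0) = 0.
Proof. by rewrite /shift (cf1_e XB) (cf2_e XB) !rmorph0 mul0r subr0. Qed.

Lemma shift_e2 : shift (e 1) = 1.
Proof. by rewrite /shift (cf1_e XB) (cf2_e XB) rmorph0 rmorph1 mul0r subr0. Qed.

Lemma shift_Vol : shift Vol = - e 0.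
Proof. by rewrite /shift (cf1_Vol XB) (cf2_Vol XB) rmorph0 rmorph1 mul1r sub0r. Qed.

Lemma shift_shift w : shift (shift w) = 0.
Proof.
rewrite {2}/shift -mulNr -rmorphN shiftD shift_emb shift_mull.
by rewrite shift_e1 mulr0 addr0.
Qed.

(** For u = da this sum is the defect of left A-linearity of delta shift + shift delta, the cross
    term in the square of a shifted delta. *)
Lemma perp_shift (delta : {linear Om X -> Om X}) v k l u w :
  in_moduli perp perpR delta lam b g v k l -> hdeg 1 u ->
  perp u (shift w) + shift (perp u w) = 0.
Proof.
move=> M u1; have P := mod_perp M.
(* [G] is additive and right A-linear, so it is enough to evaluate it on 1, e_1, e_2 and Vol. On Vol
   the two terms are b y and - b y, with y the e_2 coefficient of u. *)
pose G h := perp u (shift h) + shift (perp u h).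
have GD h h' : G (h + h') = G h + G h'.
  by rewrite /G shiftD !(perpDr M) shiftD addrACA.
have GM h a : G (h * emb a) = G h * emb a.
  by rewrite /G shift_mulr !(perp_mulr M) shift_mulr [RHS]mulrDl.
have deg1 : hdeg 0 (1 : Om X) by exists 1; rewrite rmorph1.
have G1 : G 1 = 0.
  have s1 : shift 1 = 0 by rewrite -(rmorph1 emb) shift_emb.
  by rewrite /G s1 (perp0r M) (perp_0r P u deg1) shift0 addr0.
have sp i : shift (perp u (e i)) = 0.
  by have [a ->] := perp_deg P u1 (hdeg_e X i) (erefl : (1 + 1 = 0 + 2)%N);
    apply: shift_emb.
have G2 i : G (e i) = 0.
  rewrite /G sp addr0; move: i; apply: ord2_ind; rewrite ?shift_e1 ?shift_e2.
    exact: (perp0r M).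
  exact: (perp_0r P).
have G3 : G Vol = 0.
  rewrite /G shift_Vol (perpNr M); case: u1 => x [y ->].
  rewrite !(perpDl M) !(perp_mull M) !(perp_eVol P) (perp_e1e1 P) (perp_e2e1 P).
  rewrite shiftD !shift_mull !shiftN !shiftZ shift_e1 shift_e2.
  by rewrite !(scaler0, oppr0, mulr0, add0r) mulrN opprK addrN.
rewrite -/(G w) (b1_span XB w) (vol_central XB) !(b1_central XB) !GD !GM G3 !G2.
by rewrite -[emb (cf0 w)]mul1r GM G1 !mul0r !addr0.
Qed.

(** As [shift] is an A-bimodule map, adding a multiple of it to delta keeps both product rules with
    the same [perp] and [perpR]. *)
Lemma moduli_shift (delta : {linear Om X -> Om X}) v k l kap :
  in_moduli perp perpR delta lam b g v k l -> k 0 = 0 ->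
  exists (delta' : {linear Om X -> Om X}) (l' : 'I_2 -> C),
    in_moduli perp perpR delta' lam b g v (fun i => if i == 0 then 0 else kap) l'.
Proof.
move=> M k0; have R := mod_reg M.
(* The constant term of delta e_2 is k_2 / lam and [shift] takes e_2 to 1, so this multiple turns
   k_2 into kap. *)
pose c := (kap - k 1) / lam.
pose f w := delta w + c *: shift w.
have fL : linear f.
  move=> x w h; rewrite /f linearP shift_linear !scalerDr !scalerA.
  by rewrite (mulrC c) addrACA.
pose fLM := GRing.isLinear.Build C (Om X) (Om X) *:%R f fL.
pose delta' : {linear Om X -> Om X} := HB.pack f fLM.
have fE w : delta' w = delta w + c *: shift w by [].
exists delta', (fun i => if i == 0 then - kap else 0).
have perp_sh u w := @perp_shift delta v k l u w M.
split.
- exact: (mod_perp M).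
- split.
  + by move=> w w0; rewrite fE (rc_deg0 R) //; case: w0 => a ->;
      rewrite shift_emb scaler0 addr0.
  + move=> [|[|n]] w wn; rewrite fE.
    * have [a ->] := rc_deg R wn; case: wn => x [y ->].
      exists (a + c *: y); rewrite shiftD !shift_mull shift_e1 shift_e2.
      by rewrite mulr0 add0r mulr1 rmorphD /= linearZ.
    * apply: hdegD; first exact: (rc_deg R wn).
      case: wn => a ->; exists (- c *: a), 0.
      rewrite shift_mull shift_Vol rmorph0 mul0r addr0 linearZ /= mulrN.
      by rewrite scalerN scaleNr mulNr scalerAl.
    * have -> : w = 0 by case: n wn.
      by rewrite linear0 add0r shift0 scaler0; apply: hdeg0_mem.
  + move=> a w; rewrite !fE shift_mull -(rc_left R).
    by rewrite (mulrDr _ (delta w)) -scalerAr opprD addrACA subrr addr0.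
  + move=> a w; rewrite !fE shift_mulr -(rc_right R).
    by rewrite (mulrDl (delta w)) -scalerAl opprD addrACA subrr addr0.
  + exact: (rc_bimod R).
  + exact: (rc_perpR0 R).
  + exact: (rc_perpR_deg R).
- move=> a w.
  have dl x : delta (emb a * x) = emb a * delta x + perp (dd (emb a)) x.
    by apply/eqP; rewrite addrC -subr_eq (rc_left R).
  (* The term in c^2 drops out because [shift] squares to zero. *)
  have dd' x : delta' (delta' x) =
      delta (delta x) + c *: (delta (shift x) + shift (delta x)).
    rewrite !fE shiftD shiftZ shift_shift scaler0 addr0 linearD linearZ /=.
    by rewrite -addrA -scalerDr.
  rewrite !dd' (mod_delta2 M) (mulrDr _ (delta (delta w))) -scalerAr.
  congr (_ + _ *: _).
  rewrite shift_mull !dl shiftD shift_mull (mulrDr _ (delta _)) addrACA.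
  by rewrite perp_sh ?addr0 //; exact: (hdeg_demb XB a).
- exact: (mod_jg M).
- exact: (mod_jv M).
- rewrite fE shift_e1 scaler0 addr0 (mod_delta_e1 M).
  by rewrite /atil k0.
- rewrite fE shift_e2 (mod_delta_e2 M) -emb_alg -rmorphD; congr (emb _).
  by rewrite /= /c; lin3_solve.
- rewrite fE shift_Vol (mod_delta_Vol M).
  have [l0 l1] := mod_l M.
  rewrite -!/(oneform _ _) e1_oneform !(oneformZ, oneformN, oneformD) /btil l0 l1.
  by congr oneform; rewrite /= k0 /c; lin3_solve.
- exact: (mod_v M).
- by rewrite /= mulr0 subr0.
- exact: (mod_unit M).
Qed.

End Family.

(** * Limits as lam tends to 0 along the imaginary axis *)

Section Limits.
Variable C : numClosedFieldType.
Implicit Types (f h : C -> C) (c d : C).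

#[local] Instance imag_at0_filter : Filter (@imag_at0 C).
Proof. exact: within_filter. Qed.

Lemma limit_at0_cst c : limit_at0 (fun=> c) c.
Proof. by rewrite /limit_at0; apply: cvg_cst. Qed.

Lemma limit_at0_id : limit_at0 (fun lam => lam) (0 : C).
Proof. by move=> A; apply: (@filterS _ (nbhs (0 : C)) _ A) => x Ax _ _. Qed.

Lemma imag_at0_near :
  \forall lam \near (imag_at0 : set_system C), 'Re lam = 0 /\ lam != 0.
Proof. by apply: (@filterE _ (nbhs (0 : C))) => x x0 rx. Qed.

Lemma limit_at0D f h c d : limit_at0 f c -> limit_at0 h d ->
  limit_at0 (fun lam => f lam + h lam) (c + d).
Proof. exact: cvgD. Qed.

Lemma limit_at0M f h c d : limit_at0 f c -> limit_at0 h d ->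
  limit_at0 (fun lam => f lam * h lam) (c * d).
Proof. exact: cvgM. Qed.

Lemma limit_at0N f c : limit_at0 f c -> limit_at0 (fun lam => - f lam) (- c).
Proof. exact: cvgN. Qed.

Lemma limit_at0V f c : c != 0 -> limit_at0 f c ->
  limit_at0 (fun lam => (f lam)^-1) c^-1.
Proof. exact: cvgV. Qed.

Lemma limit_at0_near f h c :
  (\forall lam \near imag_at0, h lam = f lam) -> limit_at0 f c -> limit_at0 h c.
Proof.
by move=> E; apply: cvg_trans; apply: near_eq_cvg; apply: filterS E => x ->.
Qed.

Variables (g : C -> 'M[C]_2) (g0 : 'M[C]_2).
Hypothesis g_limit : forall i j, limit_at0 (fun lam => g lam i j) (g0 i j).
Hypothesis g_unit : \forall lam \near imag_at0, g lam \in unitmx.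
Hypothesis g0_unit : g0 \in unitmx.

(** The formulas for the inverse hold where [g lam] is invertible, so their limits are transferred
    by agreement near 0. *)
Lemma limit_at0_invmx i j :
  limit_at0 (fun lam => invmx (g lam) i j) (invmx g0 i j).
Proof.
have D0 : \det g0 != 0 by rewrite -unitfE -[_ \is a _]unitmxE.
have [h00 h01 h10 h11] := invmx2E g0_unit.
have lD : limit_at0 (fun lam => (\det (g lam))^-1) (\det g0)^-1.
  apply: limit_at0V D0 _; rewrite det_mx2.
  under eq_fun do rewrite det_mx2.
  by apply: limit_at0D; [|apply: limit_at0N]; apply: limit_at0M.
move: i j; apply: ord2_ind; apply: ord2_ind; rewrite ?h00 ?h01 ?h10 ?h11.
- apply: (@limit_at0_near (fun lam => g lam 1 1 / \det (g lam))).
    by apply: filterS g_unit => x /invmx2E[].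
  exact: limit_at0M.
- apply: (@limit_at0_near (fun lam => - (g lam 0 1 / \det (g lam)))).
    by apply: filterS g_unit => x /invmx2E[].
  by apply: limit_at0N; apply: limit_at0M.
- apply: (@limit_at0_near (fun lam => - (g lam 1 0 / \det (g lam)))).
    by apply: filterS g_unit => x /invmx2E[].
  by apply: limit_at0N; apply: limit_at0M.
- apply: (@limit_at0_near (fun lam => g lam 0 0 / \det (g lam))).
    by apply: filterS g_unit => x /invmx2E[].
  exact: limit_at0M.
Qed.

Lemma limit_at0_koszul_coef (a : C -> 'I_2 -> C) (a0 : 'I_2 -> C) i j p :
  (forall q, limit_at0 (fun lam => a lam q) (a0 q)) ->
  limit_at0 (fun lam => koszul_coef lam (g lam) (a lam) i j p)
    (koszul_coef 0 g0 a0 i j p).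
Proof.
move=> a_limit; rewrite /koszul_coef.
have c_limit q : limit_at0 (fun lam => invmx (g lam) j q / 2) (invmx g0 j q / 2).
  by apply: limit_at0M; [apply: limit_at0_invmx|apply: limit_at0_cst].
move: i p; apply: ord2_ind; apply: ord2_ind => /=.
- exact: limit_at0M.
- exact: limit_at0_cst.
- apply: limit_at0D; first by apply: limit_at0N; apply: limit_at0M.
  apply: limit_at0M => //; apply: limit_at0D => //.
  by apply: limit_at0M => //; apply: limit_at0_id.
- by apply: limit_at0N; apply: limit_at0M.
Qed.

Lemma alg_limit_lin3 (X : C -> calculus C) (a : forall lam, Alg (X lam))
    (x y z : C -> C) x0 y0 z0 :
  (\forall lam \near imag_at0, a lam = lin3 (X lam) (x lam) (y lam) (z lam)) ->
  limit_at0 x x0 -> limit_at0 y y0 -> limit_at0 z z0 ->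
  alg_limit a (lin3 (X 0) x0 y0 z0).
Proof.
move=> aE xl yl zl.
(* [Negz 0] is the exponent -1, so the three monomials are r^-1 t, r^-1 and 1. *)
pose m1 : int * nat := (Negz 0, 1%N); pose m2 : int * nat := (Negz 0, 0%N).
pose m3 : int * nat := (Posz 0, 0%N).
pose c T (u v w : T) (m : int * nat) :=
  if m == m1 then u else if m == m2 then v else w.
have cE lam u v w : \sum_(m <- [:: m1; m2; m3]) c C u v w m *: monomial (X lam) m =
    lin3 (X lam) u v w.
  rewrite !big_cons big_nil /c /= /monomial /= expr1 expr0 !mulr1 addr0.
  by rewrite addrA.
exists [:: m1; m2; m3], (c _ x y z), (c _ x0 y0 z0); split.
- apply: filterS aE => lam ->; rewrite -cE; apply: eq_bigr => m _.
  by rewrite /c; case: ifP => // _; case: ifP.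
- by rewrite cE.
- by move=> m; rewrite !inE => /or3P[] /eqP ->.
Qed.

End Limits.

(** The limit connection extends [koszul_mx] at lam = 0. Its entries are the limits because
    [koszul_coef] is continuous there, and its torsion and cotorsion are the general formulas at lam
    = 0. *)
Lemma classical_limit (C : numClosedFieldType) (X : C -> calculus C)
    (perp perpR : forall lam, Om (X lam) -> Om (X lam) -> Om (X lam))
    (delta : forall lam, {linear Om (X lam) -> Om (X lam)})
    (b : C -> C) (g v : C -> 'M[C]_2) (k l : C -> 'I_2 -> C)
    (g0 : 'M[C]_2) (k0 : 'I_2 -> C) :
  (forall lam, 'Re lam = 0 -> beta1 (X lam) lam) ->
  (forall lam, 'Re lam = 0 -> lam != 0 ->
    in_moduli (perp lam) (perpR lam) (delta lam)
      lam (b lam) (g lam) (v lam) (k lam) (l lam)) ->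
  (forall i j, limit_at0 (fun lam => g lam i j) (g0 i j)) ->
  (forall i, limit_at0 (fun lam => k lam i) (k0 i)) ->
  g0 \in unitmx ->
  exists nab0 : Om (X 0) -> 'M[Alg (X 0)]_2,
  [/\ left_connection nab0,
      forall i p q : 'I_2,
        alg_limit
          (fun lam => nabla (perp lam) (delta lam) (g lam) (e i) p q)
          (nab0 (e i) p q),
      forall i : 'I_2, cotorsion nab0 (metric g0) i = cotorsion_cl g0 k0 i
    & forall i : 'I_2, torsion nab0 i = torsion_cl g0 k0 i].
Proof.
move=> Xbeta1 moduli g_limit k_limit g0_unit.
have XB0 : beta1 (X 0) 0 by apply: Xbeta1; rewrite raddf0.
have nab0E i : extend (koszul_mx (X 0) 0 g0 k0) (e i) =
  koszul_mx (X 0) 0 g0 k0 i by apply: (extend_e XB0).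
exists (extend (koszul_mx (X 0) 0 g0 k0)); split.
- exact: (extend_left_connection XB0).
- move=> i p q; rewrite nab0E koszul_mxE.
  have gu : \forall lam \near imag_at0, g lam \in unitmx.
    by apply: filterS (@imag_at0_near _) => lam [rl l0]; case: (moduli lam rl l0).
  have twog c r : limit_at0 (fun lam => 2 * g lam r c) (2 * g0 r c).
    by apply: limit_at0M => //; apply: limit_at0_cst.
  have coefs a a0 := @limit_at0_koszul_coef _ _ _ g_limit gu g0_unit a a0 i p q.
  apply: (alg_limit_lin3 _ (coefs _ _ (twog 0)) (coefs _ _ (twog 1))
    (coefs _ _ k_limit)).
  apply: filterS (@imag_at0_near _) => lam [rl l0].
  by rewrite (nabla_koszul_mx (Xbeta1 lam rl) l0 _ (moduli lam rl l0)) koszul_mxE.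
- move=> i; rewrite (cotorsion_koszul XB0 g0_unit nab0E).
  by rewrite mul0r scale0r addr0.
- move=> i; rewrite (torsion_koszul XB0 g0_unit nab0E).
  by rewrite (torsion_cl_cored _ _ g0_unit).
Qed.

(** * The Koszul connection for nonzero lam *)

Section QuantumConnection.
Variables (C : numClosedFieldType) (X : calculus C) (lam b : C).
Variables (perp perpR : Om X -> Om X -> Om X) (delta : {linear Om X -> Om X}).
Variables (g v : 'M[C]_2) (k l : 'I_2 -> C).
Hypothesis XB : beta1 X lam.
Hypothesis lam0 : lam != 0.
Hypothesis M : in_moduli perp perpR delta lam b g v k l.

Let nab := nabla perp delta g.
Let U := cored lam g k : 'I_2 -> Alg X.
Let D := \det g.
Let e11 := delta_mx 0 0 : 'M[Alg X]_2.
Let e12 := delta_mx 0 1 : 'M[Alg X]_2.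
Let e21 := delta_mx 1 0 : 'M[Alg X]_2.
Let e22 := delta_mx 1 1 : 'M[Alg X]_2.
Let ug : g \in unitmx := mod_unit M.
Let nE i : nab (e i) = koszul_mx X lam g k i := nabla_koszul_mx XB lam0 i M.

Lemma cotorsion_difference i :
  lam^-1 *: (cotorsion nab (metric g) i - cotorsion_cl g k i) = g 0 0 ^+ 2 *: U i.
Proof.
rewrite (cotorsion_koszul XB ug nE) addrAC subrr add0r.
by rewrite scalerA mulrA mulVf ?mul1r.
Qed.

Lemma connection_cored :
  [/\ nab (e 0) = (g 0 1 * D *: U 1) *: e11 - (g 0 0 * D *: U 1) *: e21,
      nab (e 1) =
        - ((D *: (g 0 1 *: U 0 - g 1 1 *: U 1)) *: e11)
        - (g 0 1 * D *: U 1) *: e12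
        + (D *: (g 0 0 *: U 0 - g 1 0 *: U 1)) *: e21
        + (g 0 0 * D *: U 1) *: e22,
      torsion nab 0 = g 0 0 * D *: U 1
    & torsion nab 1 =
        - (D *: (g 0 0 *: U 0 + (g 0 1 - g 1 0 + lam * g 0 0) *: U 1))
        - 2 *: grV].
Proof.
by split; rewrite ?(torsion_koszul XB ug nE) // nE
  ?(koszul_mx0_cored _ _ _ ug) ?(koszul_mx1_cored _ _ _ ug).
Qed.

(** This is [connection_cored] with (g^{11})^2 absorbed into the cotorsion, hence g^{11} != 0.
    Compared with the English statement, T_1 has an extra factor |g|, and in T_2 the bracket has the
    opposite sign and contains lam g^{11} in place of g^{11}. *)
Lemma connection_cotorsion (Ct := fun i => g 0 0 ^+ 2 *: U i) : g 0 0 != 0 ->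
  [/\ nab (e 0) = (g 0 1 * D / g 0 0 ^+ 2 *: Ct 1) *: e11
                  - (D / g 0 0 *: Ct 1) *: e21,
      nab (e 1) =
        - ((D / g 0 0 ^+ 2 *: (g 0 1 *: Ct 0 - g 1 1 *: Ct 1)) *: e11)
        - (g 0 1 * D / g 0 0 ^+ 2 *: Ct 1) *: e12
        + (D / g 0 0 ^+ 2 *: (g 0 0 *: Ct 0 - g 1 0 *: Ct 1)) *: e21
        + (D / g 0 0 *: Ct 1) *: e22,
      torsion nab 0 = D / g 0 0 *: Ct 1
    & torsion nab 1 =
        - (D / g 0 0 ^+ 2 *:
           (g 0 0 *: Ct 0 + (g 0 1 - g 1 0 + lam * g 0 0) *: Ct 1))
        - 2 *: grV].
Proof.
move=> g00; have [-> -> -> ->] := connection_cored.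
have KD x : D / g 0 0 ^+ 2 *: (g 0 0 ^+ 2 *: x) = D *: x :> Alg X.
  by rewrite scalerA; congr (_ *: _); field.
have K1 : g 0 1 * D / g 0 0 ^+ 2 *: Ct 1 = g 0 1 * D *: U 1.
  by rewrite scalerA; congr (_ *: _); field.
have K2 : D / g 0 0 *: Ct 1 = g 0 0 * D *: U 1.
  by rewrite scalerA; congr (_ *: _); field.
have CtC x i : x *: Ct i = g 0 0 ^+ 2 *: (x *: U i).
  by rewrite !scalerA mulrC.
by rewrite K1 K2 !CtC -!scalerBr -scalerDr !KD.
Qed.

(** Existence comes from shifting delta. The parameter is recovered from the constant term - kap /
    (2 g^{12}) of the e_1 (x) e_1 coefficient of nabla e_2. *)
Lemma weak_lc_family : weak_lc_params g k ->
  (forall kap, exists nab', wqlc_with lam b perp g kap nab') /\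
  (forall kap kap' nab1 nab2,
     wqlc_with lam b perp g kap nab1 -> wqlc_with lam b perp g kap' nab2 ->
     (forall i, nab1 (e i) = nab2 (e i)) <-> kap = kap').
Proof.
move=> wl; have [_ _ k00] := wl; split=> [kap|kap kap' nab1 nab2].
  have [delta' [l' M']] := moduli_shift XB lam0 kap M k00.
  have nE' i := nabla_koszul_mx XB lam0 i M'.
  have wl' : weak_lc_params g (fun i => if i == 0 then 0 else kap).
    by case: wl.
  exists (nabla perp delta' g), delta', perpR, v, l'.
  split=> //; split.
    by apply: ord2_ind; case: (torsion_eq0 XB ug nE' wl').
  have [_ /(_ wl')[C0 C1]] := cotorsion_eq0 XB lam0 ug nE'.
  exact: ord2_ind.
move=> [d1 [p1 [v1 [l1 [M1 -> _]]]]] [d2 [p2 [v2 [l2 [M2 -> _]]]]].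
split=> [/(_ 1)|E i]; rewrite !(nabla_koszul_mx XB lam0 _ M1)
  !(nabla_koszul_mx XB lam0 _ M2) ?E //.
move/matrixP/(_ 0 0); rewrite !koszul_mxE => /eqP; rewrite -subr_eq0 => /eqP.
rewrite !lin3E => /(lin3_eq0 XB lam0)[_ _].
have [_ D2 x0] := weak_lc_det ug wl; have [_ h01 _ _] := invmx2E ug.
have two : (2 : C) != 0 by rewrite pnatr_eq0.
rewrite /koszul_coef /= h01 D2 => E.
have nz : - (2 * g 0 1)^-1 != 0 by rewrite oppr_eq0 invr_eq0 mulf_neq0.
apply/eqP; rewrite -subr_eq0; apply/eqP/(mulfI nz); rewrite mulr0 -[RHS]E.
by field.
Qed.

Lemma levi_civita_iff : weak_lc_params g k ->
  quantum_levi_civita nab (metric g) <-> g 1 1 = - (lam * g 0 1).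
Proof.
move=> wl; have conn := nabla_left_connection XB M.
have mc := metric_compatible_koszul XB lam0 ug conn nE wl.
split=> [[_ /mc]|/mc] // mcg; split=> //.
by apply: ord2_ind; case: (torsion_eq0 XB ug nE wl).
Qed.

End QuantumConnection.

(* X lam is the beta = 1 calculus at the imaginary parameter lam (lam = 0 giving
   the classical one), delta lam the codifferential on it. *)
Theorem theorem4p4 (R : realType) (X : R[i] -> calculus R[i])
  (perp perpR : forall lam : R[i], Om (X lam) -> Om (X lam) -> Om (X lam))
  (delta : forall lam : R[i], {linear Om (X lam) -> Om (X lam)})
  (b : R[i] -> R[i]) (g v : R[i] -> 'M[R[i]]_2) (k l : R[i] -> 'I_2 -> R[i])
  (g0 : 'M[R[i]]_2) (k0 : 'I_2 -> R[i])
  (Xbeta1 : forall lam : R[i], 'Re lam = 0 -> beta1 (X lam) lam)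
  (moduli : forall lam : R[i], 'Re lam = 0 -> lam != 0 ->
     in_moduli (perp lam) (perpR lam) (delta lam)
       lam (b lam) (g lam) (v lam) (k lam) (l lam))
  (b_nonsingular : nonsingular b)
  (v_nonsingular : forall i j, nonsingular (fun lam => v lam i j))
  (l_nonsingular : forall i, nonsingular (fun lam => l lam i))
  (g_limit : forall i j, limit_at0 (fun lam => g lam i j) (g0 i j))
  (k_limit : forall i, limit_at0 (fun lam => k lam i) (k0 i))
  (g0_unit : g0 \in unitmx) :
  (* (1) *)
  (exists nab0 : Om (X 0) -> 'M[Alg (X 0)]_2,
    [/\ left_connection nab0,
        forall i p q : 'I_2,
          alg_limit
            (fun lam => nabla (perp lam) (delta lam) (g lam) (e i) p q)
            (nab0 (e i) p q),
        forall i : 'I_2, cotorsion nab0 (metric g0) i = cotorsion_cl g0 k0 i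
      & forall i : 'I_2, torsion nab0 i = torsion_cl g0 k0 i]) /\
  (forall lam : R[i], 'Re lam = 0 -> lam != 0 ->
    let nab := nabla (perp lam) (delta lam) (g lam) in
    let C := cotorsion nab (metric (g lam)) in
    let T := torsion nab in
    let Ct i := lam^-1 *: (C i - cotorsion_cl (g lam) (k lam) i) in
    let U := cored lam (g lam) (k lam) : 'I_2 -> Alg (X lam) in
    let g11 := g lam 0 0 in
    let g12 := g lam 0 1 in
    let g21 := g lam 1 0 in
    let g22 := g lam 1 1 in
    let D := \det (g lam) in
    let e11 := delta_mx 0 0 : 'M[Alg (X lam)]_2 in
    let e12 := delta_mx 0 1 : 'M[Alg (X lam)]_2 in
    let e21 := delta_mx 1 0 : 'M[Alg (X lam)]_2 in
    let e22 := delta_mx 1 1 : 'M[Alg (X lam)]_2 in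
    let wqlc := [/\ g11 = 0, g12 + g21 = 0 & k lam 0 = 0] in
    [/\ (* (2) *)
        [/\ forall i, Ct i = g11 ^+ 2 *: U i,
            g11 != 0 ->
            [/\ nab (e 0) =
                  (g12 * D / g11 ^+ 2 *: Ct 1) *: e11 - (D / g11 *: Ct 1) *: e21,
                nab (e 1) =
                  - ((D / g11 ^+ 2 *: (g12 *: Ct 0 - g22 *: Ct 1)) *: e11)
                  - (g12 * D / g11 ^+ 2 *: Ct 1) *: e12
                  + (D / g11 ^+ 2 *: (g11 *: Ct 0 - g21 *: Ct 1)) *: e21
                  + (D / g11 *: Ct 1) *: e22,
                T 0 = D / g11 *: Ct 1
              & T 1 = - (D / g11 ^+ 2 *:
                         (g11 *: Ct 0 + (g12 - g21 + lam * g11) *: Ct 1))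
                      - 2 *: grV]
          & (* the same with Ct i = g11 ^+ 2 *: U i cancelled against the powers
               of g11, which also covers g11 = 0 *)
            [/\ nab (e 0) = (g12 * D *: U 1) *: e11 - (g11 * D *: U 1) *: e21,
                nab (e 1) =
                  - ((D *: (g12 *: U 0 - g22 *: U 1)) *: e11)
                  - (g12 * D *: U 1) *: e12
                  + (D *: (g11 *: U 0 - g21 *: U 1)) *: e21
                  + (g11 * D *: U 1) *: e22,
                T 0 = g11 * D *: U 1
              & T 1 = - (D *: (g11 *: U 0 + (g12 - g21 + lam * g11) *: U 1))
                      - 2 *: grV]],
        (* (3) *)
        [/\ (C 0 = 0 /\ C 1 = 0) <-> wqlc,
            wqlc -> T 0 = 0 /\ T 1 = 0
          & wqlc ->
            (forall kap : R[i],
               exists nab', wqlc_with lam (b lam) (perp lam) (g lam) kap nab') /\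
            (forall (kap kap' : R[i]) nab1 nab2,
               wqlc_with lam (b lam) (perp lam) (g lam) kap nab1 ->
               wqlc_with lam (b lam) (perp lam) (g lam) kap' nab2 ->
               ((forall i, nab1 (e i) = nab2 (e i)) <-> kap = kap'))]
      & (* (4) *)
        wqlc ->
        (quantum_levi_civita nab (metric (g lam)) <-> g22 = - (lam * g12)) /\
        (g22 = - (lam * g12) ->
         nab (e 0) = - (grV *: e11) /\
         nab (e 1) = (grV * gt - (k lam 1 / (2 * g12))%:A) *: e11
                     - (g12 *: grV) *: metric (g lam))]).
Proof.
split; first exact: (classical_limit Xbeta1 moduli g_limit k_limit g0_unit).
move=> lam rl l0 nab C T Ct U g11 g12 g21 g22 D e11 e12 e21 e22 wqlc.
have XB := Xbeta1 lam rl; have M := moduli lam rl l0; have ug := mod_unit M.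
have nE i := nabla_koszul_mx XB l0 i M.
have CtE i : Ct i = g11 ^+ 2 *: U i by apply: (cotorsion_difference XB l0 M).
split; [split| |].
- exact: CtE.
- by rewrite !CtE; apply: (connection_cotorsion XB l0 M).
- exact: (connection_cored XB l0 M).
- split; first exact: (cotorsion_eq0 XB l0 ug nE).
    exact: (torsion_eq0 XB ug nE).
  exact: (weak_lc_family XB l0 M).
- move=> wl; split; first exact: (levi_civita_iff XB l0 M wl).
  by move=> g22E; rewrite /nab !nE; apply: (koszul_mx_weak_lc _ ug wl g22E).
Qed.
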